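(* Let $\lambda>0$, $\ell>0$ and let $\gamma\in A_\ell$ be a penalized pinned elastica. If the arclength parametrization of $\gamma$ is $\gamma_{\rm sarc}^{\lambda,\ell,2}$, $\gamma_{\rm larc}^{\lambda,\ell,2}$, or $\gamma_{\rm loop}^{\lambda,\ell,2}$ (whichever is defined), then $\gamma$ is not a local minimizer of $\mathcal{E}_\lambda$ in $A_\ell$.
   Context: Elliptic functions: for $q\in[0,1)$, $x\in\mathbb{R}$, $\mathrm{F}(x,q)=\int_0^x(1-q^2\sin^2\theta)^{-1/2}\,d\theta$, $\mathrm{E}(x,q)=\int_0^x(1-q^2\sin^2\theta)^{1/2}\,d\theta$, $\mathrm{K}(q)=\mathrm{F}(\pi/2,q)$, $\mathrm{E}(q)=\mathrm{E}(\pi/2,q)$; $\mathrm{am}(\cdot,q)$ is the inverse of $x\mapsto\mathrm{F}(x,q)$, $\mathrm{cn}(x,q)=\cos\mathrm{am}(x,q)$. The function $q\mapsto2\mathrm{E}(q)-\mathrm{K}(q)$ is strictly decreasing on $[0,1)$ with unique zero $q_*\in(0,1)$. On $[1/\sqrt2,1)$ let $f(q)=(4q^4-5q^2+1)\mathrm{K}(q)+(-8q^4+8q^2-1)\mathrm{E}(q)$ and $g(q)=8(2\mathrm{E}(q)-\mathrm{K}(q))^2(2q^2-1)$. $f$ has a unique zero $\hat q\in[1/\sqrt2,1)$; $\hat\lambda:=g(\hat q)\approx0.70107$. $g(1/\sqrt2)=0$, $g$ is strictly increasing on $[1/\sqrt2,\hat q]$, strictly decreasing on $[\hat q,q_*]$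 with $g(q_* )=0$, strictly increasing on $[q_*,1)$ with $g\to\infty$ at $1$. For $c\in(0,\hat\lambda]$ let $q_1(c)\in(1/\sqrt2,\hat q]$, $q_2(c)\in[\hat q,q_* )$ solve $g(q)=c$; for $c>0$ let $q_3(c)\in(q_*,1)$ solve $g(q)=c$. Setting: $A_\ell=\{\gamma\in W^{2,2}(0,1;\mathbb{R}^2): |\gamma'|\neq0$ on $[0,1]$, $\gamma(0)=(0,0),\ \gamma(1)=(\ell,0)\}$; $\mathcal{E}_\lambda[\gamma]=\int_\gamma k^2\,ds+\lambda L[\gamma]$. A penalized pinned elastica is $\gamma\in A_\ell$ with $\frac{d}{d\varepsilon}\mathcal{E}_\lambda[\gamma+\varepsilon\eta]|_{\varepsilon=0}=0$ for all $\eta\in W^{2,2}(0,1;\mathbb{R}^2)\cap W^{1,2}_0(0,1;\mathbb{R}^2)$. Local minimizer refers to the $W^{2,2}$-topology. Curves (arclength parametrized on $[0,4\mathrm{K}(q)/\alpha]$): if $\lambda\ell^2\le4\hat\lambda$, $\gamma_{\rm sarc}^{\lambda,\ell,2}(s)=\frac1\alpha\big(2\mathrm{E}(\mathrm{am}(\alpha s-\mathrm{K}(q),q),q)+2\mathrm{E}(q)-\alpha s,\ 2q\,\mathrm{cn}(\alpha s-\mathrm{K}(q),q)\big)$ with $q=q_1(\lambda\ell^2/4)$, $\alpha=\frac{4}{\ell}(2\mathrm{E}(q)-\mathrm{K}(q))$, and $\gamma_{\rm larc}^{\lambda,\ell,2}$ is the same formula with $q=q_2(\lambda\ell^2/4)$;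 $\gamma_{\rm loop}^{\lambda,\ell,2}(s)=\frac1\alpha\big(-2\mathrm{E}(\mathrm{am}(\alpha s-\mathrm{K}(q),q),q)-2\mathrm{E}(q)+\alpha s,\ 2q\,\mathrm{cn}(\alpha s-\mathrm{K}(q),q)\big)$ with $q=q_3(\lambda\ell^2/4)$, $\alpha=\frac{4}{\ell}(\mathrm{K}(q)-2\mathrm{E}(q))$. *)

(* Defs.v *)
From HB Require Import structures.
From mathcomp Require Import all_boot all_order all_algebra.
From mathcomp Require Import all_classical all_reals all_analysis.
Set Implicit Arguments.
Unset Strict Implicit.
Unset Printing Implicit Defensive.
Import Order.TTheory GRing.Theory Num.Theory.
Import numFieldNormedType.Exports.
Local Open Scope classical_set_scope.
Local Open Scope ring_scope.

Definition oint {R : realType} (a b : R) (f : R -> R) : R :=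
  if a <= b then Rintegral (@lebesgue_measure R) `[a, b] f
  else - Rintegral (@lebesgue_measure R) `[b, a] f.

Definition ellF {R : realType} (x q : R) : R :=
  oint 0 x (fun t => (Num.sqrt (1 - q ^+ 2 * (sin t) ^+ 2))^-1).

Definition ellE {R : realType} (x q : R) : R :=
  oint 0 x (fun t => Num.sqrt (1 - q ^+ 2 * (sin t) ^+ 2)).

Definition ellK {R : realType} (q : R) : R := ellF (pi / 2) q.
Definition ellEc {R : realType} (q : R) : R := ellE (pi / 2) q.

(* am(., q) is the inverse of x |-> F(x,q) (F(.,q) is a strictly increasing
   bijection of R for q in [0,1)); am(u,q) is the x with F(x,q) = u. *)
Definition am {R : realType} (u q : R) : R := xget 0 [set x | ellF x q = u].

Definition cn {R : realType} (u q : R) : R := cos (am u q).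

(* q_* : the unique zero of 2E(q) - K(q) in (0,1) *)
Definition qstar {R : realType} : R :=
  xget 0 [set q : R | 0 < q < 1 /\ 2 * ellEc q - ellK q = 0].

Definition fpoly {R : realType} (q : R) : R :=
  (4 * q ^+ 4 - 5 * q ^+ 2 + 1) * ellK q
  + (- 8 * q ^+ 4 + 8 * q ^+ 2 - 1) * ellEc q.

Definition gfun {R : realType} (q : R) : R :=
  8 * (2 * ellEc q - ellK q) ^+ 2 * (2 * q ^+ 2 - 1).

(* \hat q : the unique zero of f in [1/sqrt 2, 1) *)
Definition qhat {R : realType} : R :=
  xget 0 [set q : R | (Num.sqrt 2)^-1 <= q < 1 /\ fpoly q = 0].

Definition lambdahat {R : realType} : R := gfun (@qhat R).

Definition q1 {R : realType} (c : R) : R :=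
  xget 0 [set q : R | (Num.sqrt 2)^-1 < q <= qhat /\ gfun q = c].
Definition q2 {R : realType} (c : R) : R :=
  xget 0 [set q : R | qhat <= q < qstar /\ gfun q = c].
Definition q3 {R : realType} (c : R) : R :=
  xget 0 [set q : R | qstar < q < 1 /\ gfun q = c].

Definition arc_alpha {R : realType} (l q : R) : R :=
  4 / l * (2 * ellEc q - ellK q).

Definition arc_curve {R : realType} (l q : R) (s : R) : R * R :=
  let a := arc_alpha l q in
  (a^-1 * (2 * ellE (am (a * s - ellK q) q) q + 2 * ellEc q - a * s),
   a^-1 * (2 * q * cn (a * s - ellK q) q)).

Definition loop_alpha {R : realType} (l q : R) : R :=
  4 / l * (ellK q - 2 * ellEc q).

Definition loop_curve {R : realType} (l q : R) (s : R) : R * R :=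
  let a := loop_alpha l q in
  (a^-1 * (- 2 * ellE (am (a * s - ellK q) q) q - 2 * ellEc q + a * s),
   a^-1 * (2 * q * cn (a * s - ellK q) q)).

Definition q_sarc {R : realType} (lam l : R) : R := q1 (lam * l ^+ 2 / 4).
Definition q_larc {R : realType} (lam l : R) : R := q2 (lam * l ^+ 2 / 4).
Definition q_loop {R : realType} (lam l : R) : R := q3 (lam * l ^+ 2 / 4).

Definition gamma_sarc {R : realType} (lam l : R) : R -> R * R :=
  arc_curve l (q_sarc lam l).
Definition gamma_larc {R : realType} (lam l : R) : R -> R * R :=
  arc_curve l (q_larc lam l).
Definition gamma_loop {R : realType} (lam l : R) : R -> R * R :=
  loop_curve l (q_loop lam l).

Definition len_sarc {R : realType} (lam l : R) : R :=
  4 * ellK (q_sarc lam l) / arc_alpha l (q_sarc lam l).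
Definition len_larc {R : realType} (lam l : R) : R :=
  4 * ellK (q_larc lam l) / arc_alpha l (q_larc lam l).
Definition len_loop {R : realType} (lam l : R) : R :=
  4 * ellK (q_loop lam l) / loop_alpha l (q_loop lam l).

Definition vadd {R : realType} (u v : R * R) : R * R := (u.1 + v.1, u.2 + v.2).
Definition vsub {R : realType} (u v : R * R) : R * R := (u.1 - v.1, u.2 - v.2).
Definition vscale {R : realType} (a : R) (u : R * R) : R * R := (a * u.1, a * u.2).
Definition vnorm {R : realType} (u : R * R) : R := Num.sqrt (u.1 ^+ 2 + u.2 ^+ 2).
Definition vcross {R : realType} (u v : R * R) : R := u.1 * v.2 - u.2 * v.1.

Definition I01 {R : realType} : set R := `[0, 1].

Definition L2_01 {R : realType} (h : R -> R) : Prop :=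
  measurable_fun I01 h /\
  (\int[@lebesgue_measure R]_(x in I01) ((h x) ^+ 2)%:E < +oo)%E.

(* An element of W^{2,2}(0,1;R^2) is represented by its continuous
   representative g together with its (continuous) first derivative g1 and
   its weak second derivative g2 in L^2(0,1):
     g(t)  = g(0)  + \int_0^t g1,   g1(t) = g1(0) + \int_0^t g2  (t in [0,1]).
   Given g, g1 is uniquely determined on [0,1] and g2 a.e. on [0,1], and
   every quantity below only depends on these classes. *)
Definition W22 {R : realType} (g g1 g2 : R -> R * R) : Prop :=
  L2_01 (fun t => (g2 t).1) /\ L2_01 (fun t => (g2 t).2) /\
  (forall t, 0 <= t <= 1 ->
     g t = vadd (g 0) (oint 0 t (fun u => (g1 u).1), oint 0 t (fun u => (g1 u).2))) /\
  (forall t, 0 <= t <= 1 ->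
     g1 t = vadd (g1 0) (oint 0 t (fun u => (g2 u).1), oint 0 t (fun u => (g2 u).2))).

Definition W22_dist {R : realType} (g g1 g2 h h1 h2 : R -> R * R) : R :=
  Num.sqrt (Rintegral (@lebesgue_measure R) `[0, 1]
    (fun t => (vnorm (vsub (g t) (h t))) ^+ 2
            + (vnorm (vsub (g1 t) (h1 t))) ^+ 2
            + (vnorm (vsub (g2 t) (h2 t))) ^+ 2)).

Definition in_A {R : realType} (l : R) (g g1 g2 : R -> R * R) : Prop :=
  W22 g g1 g2 /\ (forall t, 0 <= t <= 1 -> g1 t <> (0, 0)) /\
  g 0 = (0, 0) /\ g 1 = (l, 0).

Definition arclen {R : realType} (g1 : R -> R * R) (t : R) : R :=
  oint 0 t (fun u => vnorm (g1 u)).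
Definition curve_length {R : realType} (g1 : R -> R * R) : R := arclen g1 1.

(* bending energy \int_g k^2 ds = \int_0^1 (g' x g'')^2 / |g'|^5 dt *)
Definition bending {R : realType} (g1 g2 : R -> R * R) : R :=
  Rintegral (@lebesgue_measure R) `[0, 1]
    (fun t => (vcross (g1 t) (g2 t)) ^+ 2 / (vnorm (g1 t)) ^+ 5).

Definition energy {R : realType} (lam : R) (g1 g2 : R -> R * R) : R :=
  bending g1 g2 + lam * curve_length g1.

Definition pinned_elastica {R : realType} (lam l : R)
    (g g1 g2 : R -> R * R) : Prop :=
  in_A l g g1 g2 /\
  forall eta eta1 eta2 : R -> R * R,
    W22 eta eta1 eta2 -> eta 0 = (0, 0) -> eta 1 = (0, 0) ->
    is_derive (0 : R) (1 : R)
      (fun eps : R => energy lam (fun t => vadd (g1 t) (vscale eps (eta1 t)))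
                                 (fun t => vadd (g2 t) (vscale eps (eta2 t))))
      0.

Definition local_minimizer {R : realType} (lam l : R)
    (g g1 g2 : R -> R * R) : Prop :=
  in_A l g g1 g2 /\
  exists delta : R, 0 < delta /\
    forall h h1 h2 : R -> R * R, in_A l h h1 h2 ->
      W22_dist g g1 g2 h h1 h2 < delta ->
      energy lam g1 g2 <= energy lam h1 h2.

Definition arclength_param_is {R : realType} (g g1 : R -> R * R)
    (X : R -> R * R) (L : R) : Prop :=
  curve_length g1 = L /\ forall t, 0 <= t <= 1 -> g t = X (arclen g1 t).

(* Main.v *)
(* The curves are wavelike elasticae X on [0, L], where L is a full period of
   the tangent T and the curvature k. Hence every shifted curve X(. + e) - X e
   has the same end points and the same energy as X, and is close to X for small
   e. If X were a local minimizer, the shifted curves would be critical too, and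
   the natural boundary condition would force their curvature to vanish at the
   end points; but k e <> 0 for small e > 0. Concretely, moving the shifted
   curve along sin (pi s / L) v, with v = 2 k N at its end points, lowers the
   energy to first order.

   The moduli are nonzero because the equations defining them are solvable:
   2 E - K is decreasing and tends to - oo at 1, and it is positive at a zero of
   fpoly. Otherwise xget would return 0 and the arcs would be straight
   segments, which are minimizers. *)

Require Import Defs.
From HB Require Import structures.
From mathcomp Require Import all_boot all_order all_algebra.
From mathcomp Require Import all_classical all_reals all_analysis.
From mathcomp Require Import measurable_realfun.
From mathcomp Require Import ring lra.
Set Implicit Arguments.
Unset Strict Implicit.
Unset Printing Implicit Defensive.
Import Order.TTheory GRing.Theory Num.Theory.
Import numFieldNormedType.Exports.
Local Open Scope classical_set_scope.
Local Open Scope ring_scope.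

(** * Calculus on the real line *)

(** The two parameters are chosen in a fixed order. The shift e alone costs no energy. The linear
    gain 2 t (pi / L) |v|^2, with |v|^2 = 4 k(e)^2, degenerates as e tends to 0, because these
    elasticae have inflection points at their ends. So e is fixed first, by the required closeness,
    and then t, so small that the gain beats an error C t^2 L. The obstacle is the parametrization.
    The given curve is an arbitrary W^{2,2} parametrization of X: its speed is only absolutely
    continuous and its second derivative is determined only almost everywhere. The competitor is
    therefore a smooth curve Z composed with the same arclength function. Both second derivatives
    are then built from the same L^2 function, the tangential acceleration, and the W^{2,2} distance
    is at most a constant times the C^2 distance of Z from X. This rests on a product rule for a C^1
    function times an indefinite integral, and on Lebesgue differentiation. The energy of the
    competitor is only bounded from above, by a continuous majorant with an explicit
    antiderivative. *)

Section calculus.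
Context {R : realType}.
Notation mu := (@lebesgue_measure R).
Implicit Types (f g : R -> R) (x a b c : R).

Lemma is_derive_eqv f x a b : is_derive x (1 : R) f a -> a = b -> is_derive x (1 : R) f b.
Proof. by move=> + <-. Qed.

Lemma is_derive_ext f g x a :
  f =1 g -> is_derive x (1 : R) f a -> is_derive x (1 : R) g a.
Proof. by move=> /funext ->. Qed.

Lemma derD f g x a b : is_derive x (1 : R) f a -> is_derive x (1 : R) g b ->
  is_derive x (1 : R) (fun y => f y + g y) (a + b).
Proof. by move=> hf hg; exact: (@is_deriveD _ _ _ f g x 1 a b). Qed.

Lemma derN f x a : is_derive x (1 : R) f a ->
  is_derive x (1 : R) (fun y => - f y) (- a).
Proof. by move=> hf; exact: (@is_deriveN _ _ _ f x 1 a). Qed.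

Lemma derM f g x a b : is_derive x (1 : R) f a -> is_derive x (1 : R) g b ->
  is_derive x (1 : R) (fun y => f y * g y) (a * g x + f x * b).
Proof.
move=> hf hg; have := @is_deriveM _ _ f g x 1 a b hf hg.
by move/is_derive_eqv; apply; rewrite /GRing.scale /= addrC (mulrC a).
Qed.

Lemma der_cst c x : is_derive x (1 : R) (fun=> c) 0.
Proof. exact: is_derive_cst. Qed.

Lemma der_id x : is_derive x (1 : R) (fun y : R => y) 1.
Proof. exact: is_derive_id. Qed.

Lemma derX f n x a : is_derive x (1 : R) f a ->
  is_derive x (1 : R) (fun y => f y ^+ n) (n%:R * f x ^+ n.-1 * a).
Proof.
elim: n => [|n IH] hf.
  apply: is_derive_eqv; last by rewrite !mul0r; reflexivity.
  by apply: is_derive_ext (der_cst 1 x) => y; rewrite expr0.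
have := derM hf (IH hf).
move/(is_derive_ext (g := fun y => f y ^+ n.+1)) => h.
apply: is_derive_eqv (h _) _; first by move=> y; rewrite exprS.
by case: n {IH h} => [|n] /=; rewrite ?expr0 -?natr1 ?exprS; ring.
Qed.

Lemma der_comp f g x a b : is_derive x (1 : R) f a -> is_derive (f x) (1 : R) g b ->
  is_derive x (1 : R) (fun y => g (f y)) (b * a).
Proof. by move=> hf hg; exact: is_derive1_comp. Qed.

Lemma is_derive_continuous f x a : is_derive x (1 : R) f a -> {for x, continuous f}.
Proof. by case=> h _; exact/differentiable_continuous/derivable1_diffP. Qed.

Lemma continuous_of_derive f g : (forall x, is_derive x (1 : R) f (g x)) -> continuous f.
Proof. by move=> h x; exact: is_derive_continuous (h x). Qed.

Lemma continuous_integrable_itv f a b : continuous f ->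
  mu.-integrable `[a, b] (EFin \o f).
Proof.
move=> cf; apply: continuous_compact_integrable; first exact: segment_compact.
exact: continuous_subspaceT.
Qed.

Lemma oint_le a b f : a <= b -> oint a b f = Rintegral mu `[a, b] f.
Proof. by rewrite /oint => ->. Qed.

Lemma oint_ge a b f : b <= a -> oint a b f = - Rintegral mu `[b, a] f.
Proof.
rewrite /oint le_eqVlt => /predU1P[->|ba]; last by rewrite leNgt ba.
by rewrite lexx set_itv1 Rintegral_set1 oppr0.
Qed.

Lemma Rintegral_cat a b c f : a <= b -> b <= c ->
  mu.-integrable `[a, c] (EFin \o f) ->
  Rintegral mu `[a, c] f = Rintegral mu `[a, b] f + Rintegral mu `[b, c] f.
Proof.
move=> ab bc intf.
have := Rintegral_itvB (x := b) intf; rewrite !bnd_simp => /(_ ab bc).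
rewrite Rintegral_itv_obnd_cbnd; last first.
  by apply: integrableS intf => //; apply: subset_itvr; rewrite bnd_simp.
by move=> <-; rewrite addrC subrK.
Qed.

Lemma oint_cat_cont f a x : continuous f -> a <= 0 -> a <= x ->
  oint 0 x f = Rintegral mu `[a, x] f - Rintegral mu `[a, 0] f.
Proof.
move=> cf a0 ax; have [x0|/ltW x0] := leP 0 x.
  have := Rintegral_cat a0 x0 (continuous_integrable_itv a x cf).
  by rewrite oint_le// => ->; lra.
have := Rintegral_cat ax x0 (continuous_integrable_itv a 0 cf).
by rewrite oint_ge// => ->; lra.
Qed.

Lemma derive_oint f x : continuous f ->
  is_derive x (1 : R) (fun y => oint 0 y f) (f x).
Proof.
(* From a base point below both 0 and x, the oriented integral is, for all y near x, an ordinary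
   integral minus a constant, whatever the sign of y. *)
move=> cf; pose a := Num.min 0 x - 1.
have [m0 mx] : Num.min 0 x <= 0 /\ Num.min 0 x <= x by rewrite !ge_min !lexx orbT.
have a0 : a <= 0 by rewrite /a; lra.
have ax : a < x by rewrite /a; lra.
have xu : x < x + 1 by rewrite ltrDl.
have [d1 d2] := continuous_FTC1_closed xu (continuous_integrable_itv a (x + 1) cf) ax (cf x).
have dI : is_derive x (1 : R) (fun y => Rintegral mu `[a, y] f - Rintegral mu `[a, 0] f) (f x).
  have d3 : is_derive x (1 : R) (fun y => Rintegral mu `[a, y] f) (f x).
    by split; [exact: d1|rewrite -derive1E; exact: d2].
  by apply: is_derive_eqv (derD d3 (derN (der_cst _ x))) _; rewrite subr0.
have e : {near x, (fun y => Rintegral mu `[a, y] f - Rintegral mu `[a, 0] f) =1 (fun y => oint 0 y f)}.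
  near=> y; rewrite (oint_cat_cont cf a0)//; apply/ltW.
  by near: y; exact: lt_nbhsr.
by apply: near_eq_is_derive e dI; rewrite ?oner_eq0.
Unshelve. all: by end_near. Qed.

Lemma oint0 f a : oint a a f = 0.
Proof. by rewrite oint_le// set_itv1 Rintegral_set1. Qed.

(** The tool behind the symmetries and periods below: equal derivatives, then one known value. *)
Lemma eq_deriv f g h x y : (forall z, is_derive z (1 : R) f (h z)) ->
  (forall z, is_derive z (1 : R) g (h z)) -> f x - f y = g x - g y.
Proof.
move=> df dg; pose k z := f z + - g z.
have dk z : is_derive z (1 : R) k 0.
  by rewrite -(subrr (h z)); apply: derD => //; exact: derN.
have := is_derive_0_is_cst x y dk; rewrite /k; lra.
Qed.

Lemma oint_derive F f x : continuous f -> (forall z, is_derive z (1 : R) F (f z)) ->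
  oint 0 x f = F x - F 0.
Proof.
move=> cf dF.
have := (@eq_deriv (fun y => oint 0 y f) F f x 0 (fun z => derive_oint z cf) dF).
by rewrite oint0 subr0.
Qed.

Lemma Rintegral_derive F f a b : a <= b -> continuous f ->
  (forall z, is_derive z (1 : R) F (f z)) -> Rintegral mu `[a, b] f = F b - F a.
Proof.
move=> ab cf dF; pose m := Num.min a 0.
have m0 : m <= 0 by rewrite ge_min lexx orbT.
have ma : m <= a by rewrite ge_min lexx.
have h := Rintegral_cat ma ab (continuous_integrable_itv m b cf).
have h1 := oint_derive a cf dF; have h2 := oint_derive b cf dF.
rewrite (oint_cat_cont cf m0) // in h1.
rewrite (oint_cat_cont cf m0) ?(le_trans ma ab) // in h2.
lra.
Qed.

Lemma derive_ge0_le f g a b : a <= b ->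
  (forall z, a <= z <= b -> is_derive z (1 : R) f (g z)) ->
  (forall z, a <= z <= b -> 0 <= g z) -> f a <= f b.
Proof.
move=> ab df g0.
have [z||c + e] := @MVT_segment _ f g a b ab.
- by rewrite in_itv/= => /andP[/ltW az /ltW zb]; apply: df; rewrite az.
- apply: derivable_within_continuous => z; rewrite in_itv/= => zab.
  by case: (df z zab).
- rewrite in_itv/= => hc; rewrite -subr_ge0 e mulr_ge0 ?subr_ge0//; exact: g0.
Qed.

Lemma derive_bound f g M a b : (forall z, is_derive z (1 : R) f (g z)) ->
  (forall z, `|g z| <= M) -> `|f b - f a| <= M * `|b - a|.
Proof.
move=> df gM; wlog ab : a b / a <= b.
  move=> h; have [/h//|/ltW/h] := leP a b.
  by rewrite distrC (distrC a).
have [|c _ ->] := MVT_segment (f := f) (df := g) ab (fun z _ => df z).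
  by apply: continuous_subspaceT; exact: continuous_of_derive df.
by rewrite normrM ler_wpM2r.
Qed.

End calculus.

(** * Continuity on the line and truncation to a segment *)

Section continuity.
Context {R : realType}.
Implicit Types (f g : R -> R) (a b x y : R).

Lemma continuousRD f g : continuous f -> continuous g -> continuous (fun x => f x + g x).
Proof. by move=> cf cg x; apply: cvgD; [exact: cf|exact: cg]. Qed.

Lemma continuousRN f : continuous f -> continuous (fun x => - f x).
Proof. by move=> cf x; apply: cvgN; exact: cf. Qed.

Lemma continuousRM f g : continuous f -> continuous g -> continuous (fun x => f x * g x).
Proof. by move=> cf cg x; apply: cvgM; [exact: cf|exact: cg]. Qed.

Lemma continuousR_cst (c : R) : continuous (fun _ : R => c).
Proof. by move=> x; exact: cvg_cst. Qed.

Lemma continuousRX f n : continuous f -> continuous (fun x => f x ^+ n).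
Proof.
move=> cf; elim: n => [|n IH]; first exact: continuousR_cst.
by rewrite (_ : (fun x => _) = (fun x => f x * f x ^+ n)); [exact: continuousRM|apply/funext => x; rewrite exprS].
Qed.

Lemma continuousRV f : (forall x, f x != 0) -> continuous f -> continuous (fun x => (f x)^-1).
Proof. by move=> f0 cf x; apply: cvgV; [exact: f0|exact: cf]. Qed.

Lemma continuousR_comp f g : continuous f -> continuous g -> continuous (fun x => g (f x)).
Proof. by move=> cf cg x; apply: continuous_comp; [exact: cf|exact: cg]. Qed.

Lemma continuousR_sqrt f : continuous f -> continuous (fun x => Num.sqrt (f x)).
Proof. by move=> cf; apply: continuousR_comp cf _; exact: sqrt_continuous. Qed.

(** Composing with this retraction onto [a, b] extends functions controlled only on a segment to the
    whole line, where the calculus lemmas apply. *)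
Definition clamp (a b x : R) : R := if x < a then a else if b < x then b else x.

Lemma clamp_itv a b x : a <= b -> a <= clamp a b x <= b.
Proof. by rewrite /clamp; case: (ltP x a); case: (ltP b x); lra. Qed.

Lemma clamp_id a b x : a <= x <= b -> clamp a b x = x.
Proof. by rewrite /clamp; case: (ltP x a); case: (ltP b x); lra. Qed.

Lemma clamp_mono a b x y : a <= b -> x <= y -> clamp a b x <= clamp a b y.
Proof.
rewrite /clamp.
by case: (ltP x a); case: (ltP b x); case: (ltP y a); case: (ltP b y); lra.
Qed.

Lemma clamp_dist a b x y : a <= b -> `|clamp a b x - clamp a b y| <= `|x - y|.
Proof.
move=> ab; wlog xy : x y / x <= y => [H|].
  by have [/H//|/ltW/H] := leP x y; rewrite distrC (distrC x).
rewrite distrC (distrC x) !ger0_norm ?subr_ge0 ?clamp_mono//.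
rewrite /clamp.
by case: (ltP x a); case: (ltP b x); case: (ltP y a); case: (ltP b y); lra.
Qed.

Lemma lipschitz_continuous (f : R -> R) k : (forall x y, `|f x - f y| <= k * `|x - y|) -> continuous f.
Proof.
move=> H x; apply/cvgrPdist_le => e e0; near=> y.
apply: le_trans (H _ _) _; apply: (@le_trans _ _ ((`|k| + 1) * `|x - y|)).
  by rewrite ler_wpM2r// (le_trans (ler_norm k))// lerDl.
rewrite -ler_pdivlMl ?ltr_wpDl//; near: y.
apply: cvgr_dist_le; first exact: cvg_id.
by rewrite mulr_gt0// invr_gt0 ltr_wpDl.
Unshelve. all: by end_near. Qed.

Lemma continuous_clamp (a b : R) : a <= b -> continuous (clamp a b).
Proof.
move=> ab; apply: (@lipschitz_continuous _ 1) => x y.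
by rewrite mul1r; exact: clamp_dist.
Qed.

Lemma continuous_comp_clamp f (a b : R) : a <= b ->
  {within `[a, b], continuous f} -> continuous (fun x => f (clamp a b x)).
Proof.
move=> ab /subspace_continuousP cf x.
have cx : [set` `[a, b]] (clamp a b x) by rewrite /= in_itv/= clamp_itv.
apply: cvg_comp (cf _ cx) => P.
rewrite /within/= => h; have := continuous_clamp ab; move=> /(_ x _ h).
by rewrite /= nbhs_simpl/=; apply: filterS => y; apply; rewrite /= in_itv/= clamp_itv.
Qed.

Lemma continuous_oint_clamp f (a : R) : 0 <= a ->
  (@lebesgue_measure R).-integrable `[0, a] (EFin \o f) ->
  continuous (fun x => oint 0 (clamp 0 a x) f).
Proof.
move=> a0 hf; have := continuous_comp_clamp a0 (parameterized_integral_continuous a0 hf).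
rewrite (_ : (fun x => _) = (fun x => oint 0 (clamp 0 a x) f))//; apply/funext => x.
by rewrite oint_le//; have /andP[] := clamp_itv x a0.
Qed.

(** Two-sided derivatives can be compared only inside an interval; this carries the resulting
    identity to the end points. *)
Lemma continuous_eq0_itv f (a b : R) : a < b -> continuous f ->
  (forall x, a < x < b -> f x = 0) -> forall x, a <= x <= b -> f x = 0.
Proof.
move=> ab cf f0 x /andP[]; rewrite !le_eqVlt => /predU1P[<- _|ax /predU1P[->|xb]].
- have h : f y @[y --> a^'+] --> f a by apply: cvg_at_right_filter; exact: cf.
  have h0 : f y @[y --> a^'+] --> (0 : R).
    apply: cvg_near_cst; near=> y; apply: f0; apply/andP; split; near: y.
      exact: nbhs_right_gt.
    exact: nbhs_right_lt.
  exact: cvg_unique h h0.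
- have h : f y @[y --> b^'-] --> f b by apply: cvg_at_left_filter; exact: cf.
  have h0 : f y @[y --> b^'-] --> (0 : R).
    apply: cvg_near_cst; near=> y; apply: f0; apply/andP; split; near: y.
      exact: nbhs_left_gt.
    exact: nbhs_left_lt.
  exact: cvg_unique h h0.
- by apply: f0; rewrite ax.
Unshelve. all: by end_near. Qed.

End continuity.

(** * Indefinite integrals of integrable functions *)

Section absolutely_continuous.
Context {R : realType}.
Notation mu := (@lebesgue_measure R).
Implicit Types (f g F n nu : R -> R) (a b c s t : R).

Local Notation itv_integrable a b f :=
  (mu.-integrable `[a, b] (EFin \o f)).

Lemma itv_integrableD a b f g : itv_integrable a b f -> itv_integrable a b g ->
  itv_integrable a b (fun x => f x + g x).
Proof. by move=> hf hg; exact: (@integrableD _ _ _ mu `[a, b] _ (EFin \o f) (EFin \o g)). Qed.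

Lemma itv_integrableZ a b c f : itv_integrable a b f ->
  itv_integrable a b (fun x => c * f x).
Proof. by move=> hf; exact: (@integrableZl _ _ _ mu `[a, b] _ c (EFin \o f)). Qed.

Lemma itv_integrable_norm a b f : itv_integrable a b f ->
  itv_integrable a b (fun x => `|f x|).
Proof. by move=> hf; exact: (@integrable_norm _ _ _ mu `[a, b] f). Qed.

Lemma itv_integrableS a b s t f : a <= s -> t <= b -> itv_integrable a b f ->
  itv_integrable s t f.
Proof.
move=> as_ tb; apply: integrableS => //.
by apply: subset_itv; rewrite bnd_simp.
Qed.

Lemma continuous_bounded_itv a b f : continuous f -> [bounded f x | x in `[a, b]].
Proof.
move=> cf; have : compact (f @` `[a, b]).
  by apply: continuous_compact; [exact: continuous_subspaceT|exact: segment_compact].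
by move=> /compact_bounded [M [Mr Mf]]; exists M; split => // x /Mf h t tab; apply: h; exists t.
Qed.

Lemma itv_integrableM a b F f : continuous F -> itv_integrable a b f ->
  itv_integrable a b (fun x => F x * f x).
Proof.
move=> cF hf; apply: (@integrableMr _ _ _ mu `[a, b] _ F (EFin \o f)) => //; last exact: continuous_bounded_itv.
by apply: measurable_funTS; exact: continuous_measurable_fun.
Qed.

Lemma itv_integrable_cont a b f : continuous f -> itv_integrable a b f.
Proof. exact: continuous_integrable_itv. Qed.

Lemma Rintegral_itv_cst a b c : a <= b -> Rintegral mu `[a, b] (fun=> c) = c * (b - a).
Proof.
move=> ab; have dF z : is_derive z (1 : R) (fun y => c * y) c.
  by apply: is_derive_eqv (derM (der_cst c z) (der_id z)) _; rewrite mul0r add0r mulr1.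
rewrite (Rintegral_derive ab _ dF); last by move=> z; exact: cvg_cst.
by rewrite mulrBr.
Qed.

Lemma oint_sub f s t : 0 <= s -> s <= t -> itv_integrable 0 t f ->
  oint 0 t f - oint 0 s f = Rintegral mu `[s, t] f.
Proof.
move=> s0 st hf; rewrite !oint_le// ?(le_trans s0 st)//.
by rewrite (Rintegral_cat s0 st hf) addrAC subrr add0r.
Qed.

Lemma norm_Rintegral_le a b f g : itv_integrable a b f -> itv_integrable a b g ->
  (forall x, a <= x <= b -> `|f x| <= g x) ->
  `|Rintegral mu `[a, b] f| <= Rintegral mu `[a, b] g.
Proof.
move=> hf hg fg; apply: (le_trans (@le_normr_Rintegral _ _ _ mu `[a, b] f _ hf)) => //.
by apply: le_Rintegral => //; exact: itv_integrable_norm.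
Qed.

(* Cutting [0, t] into N equal pieces bounds the total increment of r by
   C t (m t - m 0) / N. *)
Lemma increment_cst (r m : R -> R) C t :
  (forall a b, 0 <= a -> a <= b -> b <= t -> `|r b - r a| <= C * (b - a) * (m b - m a)) ->
  0 <= t -> r t = r 0.
Proof.
move=> H t0; apply/eqP; rewrite -subr_eq0 -normr_eq0; apply/negP => /negP h.
have hp : 0 < `|r t - r 0| by rewrite lt_neqAle eq_sym h normr_ge0.
pose K := C * t * (m t - m 0).
have step (N k : nat) : (0 < N)%N -> (k <= N)%N ->
    `|r (t * k%:R / N%:R) - r 0| <= C * (t / N%:R) * (m (t * k%:R / N%:R) - m 0).
  move=> N0; elim: k => [_|k IH kN].
    by rewrite mulr0 mul0r !subrr normr0 mulr0.
  have Np : (0 : R) < N%:R by rewrite ltr0n.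
  pose a := t * k%:R / N%:R; pose b := t * k.+1%:R / N%:R.
  have ba : b - a = t / N%:R by rewrite /b /a -natr1; field; rewrite gt_eqF.
  have a0 : 0 <= a by rewrite !mulr_ge0// invr_ge0 ltW.
  have ab : a <= b by rewrite -subr_ge0 ba mulr_ge0// invr_ge0 ltW.
  have bt : b <= t by rewrite ler_pdivrMr// ler_wpM2l// ler_nat.
  have := H _ _ a0 ab bt; have := IH (ltnW kN); rewrite -/a -/b ba.
  have := ler_normD (r b - r a) (r a - r 0); rewrite addrA subrK.
  set X := C * _; rewrite !mulrBr; lra.
have bound (N : nat) : (0 < N)%N -> `|r t - r 0| * N%:R <= K.
  move=> N0; have := step N N N0 (leqnn N).
  have Np : (0 : R) < N%:R by rewrite ltr0n.
  rewrite mulfK ?gt_eqF// => h1; rewrite -ler_pdivlMr//; apply: le_trans h1 _.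
  by rewrite /K mulrA mulrAC.
have := truncnS_gt (K / `|r t - r 0|); rewrite ltr_pdivrMr// mulrC.
by rewrite ltNge bound.
Qed.

Lemma oint_diff_le f s t T : 0 <= s -> s <= t -> t <= T -> itv_integrable 0 T f ->
  `|oint 0 t f - oint 0 s f| <=
     oint 0 t (fun x => `|f x|) - oint 0 s (fun x => `|f x|).
Proof.
move=> s0 st tT hf; have ht : itv_integrable 0 t f by apply: itv_integrableS tT hf.
rewrite !oint_sub//; last exact: itv_integrable_norm.
apply: norm_Rintegral_le => [| |x _].
- exact: itv_integrableS (lexx t) ht.
- by apply: itv_integrable_norm; exact: itv_integrableS (lexx t) ht.
- exact: lexx.
Qed.

(* On [s, t] the increment of F n minus that of the claimed integral is the
   integral of (F t - F v) nu v + (n s - n v) f v, which is of second order. *)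
Lemma oint_product F f n nu T : 0 <= T ->
  continuous f -> (forall x, is_derive x (1 : R) F (f x)) ->
  continuous n -> itv_integrable 0 T nu ->
  (forall t, 0 <= t <= T -> n t = n 0 + oint 0 t nu) ->
  forall t, 0 <= t <= T ->
  F t * n t = F 0 * n 0 + oint 0 t (fun v => f v * n v + F v * nu v).
Proof.
move=> T0 cf dF cn inu nE t /andP[t0 tT].
have cF := continuous_of_derive dF.
have ip a b : 0 <= a -> b <= T -> itv_integrable a b (fun v => f v * n v + F v * nu v).
  move=> a0 bT; apply: itv_integrableS a0 bT _; apply: itv_integrableD.
    by apply: itv_integrable_cont => x; apply: cvgM; [exact: cf|exact: cn].
  exact: itv_integrableM.
have [C C0 fC] : exists2 C, 0 <= C & forall x, 0 <= x <= T -> `|f x| <= C.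
  have [M [Mr Mf]] := continuous_bounded_itv 0 T cf.
  exists (`|M| + 1); first by rewrite addr_ge0.
  move=> x x0T; apply: Mf; last by rewrite /= in_itv.
  by rewrite (le_lt_trans (ler_norm M))// ltrDl.
have FC a b : 0 <= a -> a <= b -> b <= T -> `|F b - F a| <= C * (b - a).
  move=> a0 ab bT.
  have [|c + ->] := MVT_segment (f := F) (df := f) ab (fun z _ => dF z).
    exact: continuous_subspaceT.
  rewrite in_itv/= => /andP[ac cb]; rewrite normrM (@ger0_norm _ (b - a)) ?subr_ge0//.
  by rewrite ler_wpM2r ?subr_ge0// fC// (le_trans a0 ac) (le_trans cb bT).
(* [m] controls the variation of [n], which need not be Lipschitz because [nu] is only
   integrable. *)
pose m x := oint 0 x (fun v => `|nu v|).
have nm a b : 0 <= a -> a <= b -> b <= T -> `|n b - n a| <= m b - m a.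
  move=> a0 ab bT; rewrite (nE b) ?(le_trans a0 ab)// (nE a) ?a0 ?(le_trans ab bT)//.
  by rewrite [n 0 + _]addrC addrKA; exact: oint_diff_le a0 ab bT inu.
pose r x := F x * n x - oint 0 x (fun v => f v * n v + F v * nu v).
suff : r t = r 0 by rewrite /r oint0; lra.
(* One [C] bounds the slope of [F] in the term with [nu], the other bounds [f] in the term with the
   increment of [n]. *)
apply: (@increment_cst r m (C + C)) => // a b a0 ab bt.
have bT := le_trans bt tT.
have mab : 0 <= m b - m a by exact: le_trans (normr_ge0 _) (nm _ _ a0 ab bT).
have inuab : itv_integrable a b nu by exact: itv_integrableS a0 bT inu.
have -> : r b - r a = Rintegral mu `[a, b]
    (fun v => (F b - F v) * nu v + (n a - n v) * f v).
  have -> : (fun v => (F b - F v) * nu v + (n a - n v) * f v) =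
      (fun v => (F b * nu v + n a * f v) + -1 * (f v * n v + F v * nu v)).
    by apply/funext => v; ring.
  have i1 : itv_integrable a b (fun v => F b * nu v) by exact: itv_integrableZ.
  have i2 : itv_integrable a b (fun v => n a * f v).
    by apply: itv_integrableZ; exact: itv_integrable_cont.
  have i3 := ip a b a0 bT.
  rewrite (RintegralD _ (itv_integrableD i1 i2) (itv_integrableZ (-1) i3))//.
  rewrite (RintegralD _ i1 i2)// !RintegralZl//; last exact: itv_integrable_cont.
  rewrite (Rintegral_derive ab cf dF).
  rewrite -(oint_sub a0 ab (itv_integrableS (lexx 0) bT inu)).
  rewrite -(oint_sub a0 ab (ip 0 b (lexx 0) bT)).
  have := nE b; rewrite (le_trans a0 ab) bT => /(_ isT).
  have := nE a; rewrite a0 (le_trans ab bT) => /(_ isT).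
  rewrite /r => ha hb.
  have -> : oint 0 b nu - oint 0 a nu = n b - n a by rewrite ha hb; ring.
  ring.
apply: (@le_trans _ _ (Rintegral mu `[a, b]
    (fun v => C * (b - a) * `|nu v| + (m b - m a) * C))).
  apply: norm_Rintegral_le.
  - have e : (fun v => (F b - F v) * nu v + (n a - n v) * f v) =
      (fun v => (F b * nu v + -1 * (F v * nu v)) + (n a * f v + -1 * (n v * f v))).
      by apply/funext => v; ring.
    rewrite e; apply: itv_integrableD; apply: itv_integrableD; do ?apply: itv_integrableZ => //.
    + exact: itv_integrableM.
    + exact: itv_integrable_cont.
    + by apply: itv_integrable_cont => x; apply: cvgM; [exact: cn|exact: cf].
  - apply: itv_integrableD; last by apply: itv_integrable_cont => x; exact: cvg_cst.
    by apply: itv_integrableZ; exact: itv_integrable_norm.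
  - move=> v /andP[av vb]; apply: le_trans (ler_normD _ _) _; rewrite !normrM.
    have v0 := le_trans a0 av; have vT := le_trans vb bT.
    apply: lerD; first rewrite ler_wpM2r//.
      apply: le_trans (FC _ _ v0 vb bT) _; rewrite ler_wpM2l//; lra.
    apply: ler_pM => //; last by apply: fC; rewrite v0.
    rewrite distrC; apply: le_trans (nm _ _ a0 av vT) _.
    have := le_trans (normr_ge0 _) (nm _ _ v0 vb bT); lra.
have i1 := itv_integrable_norm inuab.
rewrite (RintegralD _ (itv_integrableZ _ i1))//; last first.
  by apply: itv_integrable_cont => x; exact: cvg_cst.
rewrite RintegralZl// Rintegral_itv_cst//.
rewrite -(oint_sub a0 ab); last exact: itv_integrable_norm (itv_integrableS (lexx 0) bT inu).
rewrite -/(m a) -/(m b) le_eqVlt; apply/orP; left; apply/eqP; ring.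
Qed.

Lemma ae_neq a : {ae mu, forall x, x != a}.
Proof.
exists [set a]; split => //; first exact: lebesgue_measure_set1.
by move=> x /= /negP; rewrite negbK => /eqP.
Qed.

(** Lebesgue differentiation: at almost every point [f] is the derivative of its primitive.
    Extension by zero makes [f] locally integrable, and discarding the points 0 and T leaves points
    near which the primitive vanishes identically. *)
Lemma oint_eq0_ae f T : itv_integrable 0 T f ->
  (forall t, 0 <= t <= T -> oint 0 t f = 0) ->
  {ae mu, forall x, 0 <= x <= T -> f x = 0}.
Proof.
move=> hf f0.
have h1 y : mu.-integrable [set` Interval (BLeft 0) (BRight y)] (EFin \o (f \_ `[0, T])).
  rewrite -restrict_EFin; apply/integrable_restrict => //.
  apply: integrableS hf; [exact: measurable_itv|exact: measurableI|exact: subIsetr].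
have := FTC1 h1 (integrable_locally_restrict (measurable_itv `[0, T]) hf).
apply: (@filterS3 _ _ (ae_filter_ringOfSetsType mu) _ _ _ _ _ (ae_neq 0) (ae_neq T)) => x xn0 xnT H.
move=> /andP[x0 xT].
have {xn0}x0' : 0 < x by rewrite lt_neqAle eq_sym xn0.
have {xnT}xT' : x < T by rewrite lt_neqAle xnT.
have [_] := H x0'.
rewrite patchE mem_set/= ?in_itv/= ?x0 ?xT//.
have : is_derive x (1 : R) (fun y => Rintegral mu `[0, y] (f \_ `[0, T])) 0.
  suff e : {near x, (fun=> 0) =1 (fun y => Rintegral mu `[0, y] (f \_ `[0, T]))}.
    by apply: near_eq_is_derive e (der_cst 0 x); rewrite oner_eq0.
  near=> y; have y0 : 0 <= y by apply/ltW; near: y; exact: lt_nbhsr.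
  have yT : y <= T by apply/ltW; near: y; exact: lt_nbhsl.
  rewrite -[LHS](f0 y) ?y0// oint_le//; apply: eq_Rintegral => z.
  rewrite inE/= in_itv/= => /andP[z0 zy].
  by rewrite ?patchE mem_set//= in_itv/= z0 (le_trans zy).
by move=> [_]; rewrite -derive1E => ->.
Unshelve. all: by end_near. Qed.

End absolutely_continuous.

(** * Square-integrable functions on the unit interval *)

Section L2.
Context {R : realType}.
Notation mu := (@lebesgue_measure R).
Implicit Types f g F : R -> R.
Local Notation itv_integrable a b f := (mu.-integrable `[a, b] (EFin \o f)).

Lemma L2_01P f : L2_01 f <-> measurable_fun (`[0, 1] : set R) f /\ itv_integrable 0 1 (fun x => f x ^+ 2).
Proof.
split=> -[mf h]; split => //.
  apply/integrableP; split.
    by apply/measurable_EFinP; apply: measurable_funX.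
  apply: le_lt_trans h; apply: ge0_le_integral => //=.
  - by apply/measurable_EFinP; apply: measurableT_comp => //; apply: measurable_funX.
  - by apply/measurable_EFinP; apply: measurable_funX.
  - by move=> x _; rewrite lee_fin ger0_norm// sqr_ge0.
move/integrableP : h => [_]; apply: le_lt_trans.
rewrite le_eqVlt; apply/orP; left; apply/eqP; apply: eq_integral => x _ /=.
by rewrite ger0_norm// sqr_ge0.
Qed.

Lemma le_itv_integrable f g : measurable_fun (`[0, 1] : set R) f ->
  (forall x, `|f x| <= g x) -> itv_integrable 0 1 g -> itv_integrable 0 1 f.
Proof.
move=> mf fg; apply: le_integrable => //; first exact/measurable_EFinP.
by move=> x _ /=; rewrite lee_fin; apply: le_trans (fg x) (ler_norm _).
Qed.

Lemma itv_measurable_cont F : continuous F -> measurable_fun (`[0, 1] : set R) F.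
Proof. by move=> cF; apply: measurable_funTS; exact: continuous_measurable_fun. Qed.

Lemma L2_integrable f : L2_01 f -> itv_integrable 0 1 f.
Proof.
move=> /L2_01P[mf h]; apply: (le_itv_integrable (g := fun x => 1 + f x ^+ 2) mf).
  by move=> x; rewrite ler_norml; have := sqr_ge0 (f x - 1); have := sqr_ge0 (f x + 1); nra.
by apply: itv_integrableD => //; apply: itv_integrable_cont; exact: continuousR_cst.
Qed.

Lemma L2D f g : L2_01 f -> L2_01 g -> L2_01 (fun x => f x + g x).
Proof.
move=> /L2_01P[mf hf] /L2_01P[mg hg]; apply/L2_01P.
have m : measurable_fun (`[0, 1] : set R) (fun x => f x + g x) by exact: measurable_funD.
split => //; apply: (le_itv_integrable (g := fun x => 2 * f x ^+ 2 + 2 * g x ^+ 2)).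
- exact: measurable_funX.
- move=> x; rewrite ger0_norm ?sqr_ge0//; have := sqr_ge0 (f x - g x); nra.
- by apply: itv_integrableD; exact: itv_integrableZ.
Qed.

Lemma L2M F f : continuous F -> L2_01 f -> L2_01 (fun x => F x * f x).
Proof.
move=> cF /L2_01P[mf hf]; apply/L2_01P; split.
  by apply: measurable_funM => //; exact: itv_measurable_cont.
rewrite (_ : (fun x => _) = (fun x => F x ^+ 2 * f x ^+ 2)); last by apply/funext => x; rewrite exprMn.
by apply: itv_integrableM => //; exact: continuousRX.
Qed.

Lemma L2_cont F : continuous F -> L2_01 F.
Proof.
move=> cF; apply/L2_01P; split; first exact: itv_measurable_cont.
by apply: itv_integrable_cont; exact: continuousRX.
Qed.

Lemma L2B f g : L2_01 f -> L2_01 g -> L2_01 (fun x => f x - g x).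
Proof.
move=> hf hg; rewrite (_ : (fun x => _) = (fun x => f x + (- 1) * g x)).
  by apply: L2D hf _; apply: L2M hg; exact: continuousR_cst.
by apply/funext => x; rewrite mulN1r.
Qed.

Lemma L2_sqr_integrable f : L2_01 f -> itv_integrable 0 1 (fun x => f x ^+ 2).
Proof. by case/L2_01P. Qed.

Lemma Rintegral_ae_eq f g : measurable_fun (`[0, 1] : set R) f -> measurable_fun (`[0, 1] : set R) g ->
  {ae mu, forall x, 0 <= x <= 1 -> f x = g x} ->
  Rintegral mu `[0, 1] f = Rintegral mu `[0, 1] g.
Proof.
move=> mf mg h; congr fine; apply: ae_eq_integral => //; do ?exact/measurable_EFinP.
apply: (@filterS _ _ (ae_filter_ringOfSetsType mu) _ _ _ h) => x /= fg x01; congr EFin; apply: fg.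
by move: x01; rewrite /= in_itv.
Qed.

End L2.

(** * Jacobi elliptic functions *)

Section jacobi.
Context {R : realType}.
Implicit Types q x u : R.

Definition delta2 (q x : R) : R := 1 - q ^+ 2 * sin x ^+ 2.

Lemma sin2_le1 x : sin x ^+ 2 <= 1.
Proof. by rewrite -(cos2Dsin2 x); have := sqr_ge0 (cos x); lra. Qed.

Lemma delta2_ge q x : 1 - q ^+ 2 <= delta2 q x.
Proof.
rewrite /delta2; have := sin2_le1 x; have := sqr_ge0 q.
have := sqr_ge0 (sin x); nra.
Qed.

Lemma delta2_le1 q x : delta2 q x <= 1.
Proof. by rewrite /delta2 gerBl mulr_ge0// sqr_ge0. Qed.

Lemma delta2_gt0 q x : 0 <= q < 1 -> 0 < delta2 q x.
Proof. move=> hq; apply: lt_le_trans (delta2_ge q x); nra. Qed.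

Definition delta (q x : R) : R := Num.sqrt (delta2 q x).

Lemma delta_sqr q x : 0 <= q < 1 -> delta q x ^+ 2 = delta2 q x.
Proof. by move=> hq; rewrite sqr_sqrtr// ltW// delta2_gt0. Qed.

Lemma delta_gt0 q x : 0 <= q < 1 -> 0 < delta q x.
Proof. by move=> hq; rewrite sqrtr_gt0 delta2_gt0. Qed.

Lemma delta_le1 q x : delta q x <= 1.
Proof. by rewrite -[leRHS]sqrtr1 ler_sqrt// delta2_le1. Qed.

Lemma derive_delta2 q x :
  is_derive x (1 : R) (delta2 q) (- (2 * q ^+ 2 * sin x * cos x)).
Proof.
apply: is_derive_eqv
  (derD (der_cst 1 x) (derN (derM (der_cst (q ^+ 2) x) (derX 2 (is_derive_sin x))))) _.
rewrite /=; ring.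
Qed.

Lemma derive_delta q x : 0 <= q < 1 ->
  is_derive x (1 : R) (delta q) (- (q ^+ 2 * sin x * cos x) / delta q x).
Proof.
move=> hq.
have h : is_derive (delta2 q x) (1 : R) Num.sqrt (2 * Num.sqrt (delta2 q x))^-1.
  exact: is_derive1_sqrt (delta2_gt0 x hq).
apply: is_derive_eqv (der_comp (derive_delta2 q x) h) _.
rewrite -/(delta q x); have := delta_gt0 x hq => d0.
by field; rewrite gt_eqF.
Qed.

Lemma continuous_delta q : 0 <= q < 1 -> continuous (delta q).
Proof. by move=> hq x; exact: is_derive_continuous (derive_delta x hq). Qed.

Lemma continuous_deltaV q : 0 <= q < 1 -> continuous (fun x => (delta q x)^-1).
Proof.
move=> hq x; apply: cvgV; [by rewrite gt_eqF// delta_gt0|exact: continuous_delta].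
Qed.

Lemma derive_ellF q x : 0 <= q < 1 ->
  is_derive x (1 : R) (fun y => ellF y q) (delta q x)^-1.
Proof. by move=> hq; exact: derive_oint (continuous_deltaV hq). Qed.

Lemma derive_ellE q x : 0 <= q < 1 ->
  is_derive x (1 : R) (fun y => ellE y q) (delta q x).
Proof. by move=> hq; exact: derive_oint (continuous_delta hq). Qed.

Lemma ellF0 q : ellF 0 q = 0 :> R.
Proof. exact: oint0. Qed.

(** The integrand 1 / [delta] is at least 1. This expansion property yields injectivity,
    surjectivity through the intermediate value theorem on [-|u|, |u|], and K > 0. *)
Lemma ellF_diff_ge q x y : 0 <= q < 1 -> x <= y -> y - x <= ellF y q - ellF x q.
Proof.
move=> hq xy; have d z : is_derive z (1 : R) (fun y => ellF y q + - y) ((delta q z)^-1 + - 1).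
  exact: (derD (derive_ellF z hq) (derN (der_id z))).
have := derive_ge0_le xy (fun z _ => d z); set P := (X in (X -> _) -> _); suff h : P by move=> /(_ h); lra.
by move=> z _; rewrite subr_ge0 invf_ge1 ?delta_gt0// delta_le1.
Qed.

Lemma ellF_inj q : 0 <= q < 1 -> injective (fun x => ellF x q).
Proof.
move=> hq x y /= e; have [xy|/ltW xy] := leP x y; have := ellF_diff_ge hq xy; lra.
Qed.

Lemma ellF_surj q u : 0 <= q < 1 -> exists x, ellF x q = u.
Proof.
move=> hq; have ab : - `|u| <= `|u| by rewrite -subr_ge0 opprK addr_ge0.
have cF : {within `[- `|u|, `|u|], continuous (fun x => ellF x q)}.
  by apply: continuous_subspaceT; apply: continuous_of_derive => x; exact: derive_ellF.
have h1 := ellF_diff_ge hq (normr_ge0 u).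
have h2 : - `|u| <= 0 by rewrite oppr_le0.
have {}h2 := ellF_diff_ge hq h2; rewrite ellF0 in h1 h2.
have := ler_norm u; have := ler_norm (- u); rewrite normrN => h3 h4.
have [|x _ <-] := IVT (v := u) ab cF; last by exists x.
rewrite ge_min le_max; apply/andP; split; apply/orP; [left|right]; lra.
Qed.

Lemma ellF_am q u : 0 <= q < 1 -> ellF (am u q) q = u.
Proof. by move=> hq; rewrite /am; case: xgetP => [y ->//|]; have [x e] := ellF_surj u hq => /(_ x). Qed.

Lemma am_ellF q x : 0 <= q < 1 -> am (ellF x q) q = x.
Proof. by move=> hq; apply: (ellF_inj hq); rewrite ellF_am. Qed.

Lemma derive_am q u : 0 <= q < 1 ->
  is_derive u (1 : R) (fun u => am u q) (delta q (am u q)).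
Proof.
move=> hq; rewrite -[X in is_derive X](ellF_am u hq) -[delta _ _]invrK.
apply: (is_derive_inverse (f := fun x => ellF x q)).
- by near=> z; exact: am_ellF.
- by near=> z; apply: continuous_of_derive => x; exact: derive_ellF.
- exact: derive_ellF.
- by rewrite invr_eq0 gt_eqF// delta_gt0.
Unshelve. all: by end_near. Qed.

Lemma am_lt q u v : 0 <= q < 1 -> u < v -> am u q < am v q.
Proof.
move=> hq uv; rewrite ltNge; apply/negP => h; have := ellF_diff_ge hq h.
by rewrite !ellF_am//; lra.
Qed.

Lemma ellFN q x : 0 <= q < 1 -> ellF (- x) q = - ellF x q.
Proof.
move=> hq.
have d1 z : is_derive z (1 : R) (fun x => ellF (- x) q) (- (delta q z)^-1).
  apply: is_derive_eqv (der_comp (derN (der_id z)) (derive_ellF (- z) hq)) _.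
  by rewrite /delta /delta2 sinN sqrrN mulrN1.
have d2 z : is_derive z (1 : R) (fun x => - ellF x q) (- (delta q z)^-1).
  exact: derN (derive_ellF z hq).
by have := eq_deriv x 0 d1 d2; rewrite oppr0 ellF0; lra.
Qed.

(** The reflection x -> pi - x preserves [delta]. *)
Lemma ellF_pi (q : R) : 0 <= q < 1 -> ellF pi q = 2 * ellK q.
Proof.
move=> hq.
have d1 z : is_derive z (1 : R) (fun x => ellF (pi - x) q) (- (delta q z)^-1).
  have d0 : is_derive z (1 : R) (fun x => pi - x) (0 - 1).
    exact: (derD (der_cst pi z) (derN (der_id z))).
  apply: is_derive_eqv (der_comp d0 (derive_ellF (pi - z) hq)) _.
  by rewrite /delta /delta2 sinB sinpi cospi mul0r mulN1r sub0r opprK sub0r mulrN1.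
have d2 z : is_derive z (1 : R) (fun x => - ellF x q) (- (delta q z)^-1).
  exact: derN (derive_ellF z hq).
have := eq_deriv (pi / 2) 0 d1 d2; rewrite subr0 ellF0 /ellK.
have -> : pi - pi / 2 = pi / 2 :> R by field.
lra.
Qed.

Lemma ellF_addpi q x : 0 <= q < 1 -> ellF (x + pi) q = ellF x q + 2 * ellK q.
Proof.
move=> hq.
have d1 z : is_derive z (1 : R) (fun x => ellF (x + pi) q) ((delta q z)^-1).
  have d0 : is_derive z (1 : R) (fun x => x + pi) (1 + 0).
    exact: (derD (der_id z) (der_cst pi z)).
  apply: is_derive_eqv (der_comp d0 (derive_ellF (z + pi) hq)) _.
  by rewrite /delta /delta2 sinDpi sqrrN addr0 mulr1.
have := eq_deriv x 0 d1 (fun z => derive_ellF z hq); rewrite add0r ellF0 ellF_pi//; lra.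
Qed.

Lemma am_period q u : 0 <= q < 1 -> am (u + 4 * ellK q) q = am u q + pi *+ 2.
Proof.
move=> hq; apply: (ellF_inj hq); rewrite /= ellF_am// mulr2n addrA !ellF_addpi// ellF_am//.
ring.
Qed.

Lemma ellK_gt0 (q : R) : 0 <= q < 1 -> 0 < ellK q.
Proof.
move=> hq; have p0 : (0 : R) < pi / 2 by rewrite divr_gt0// pi_gt0.
have := ellF_diff_ge hq (ltW p0); rewrite ellF0 /ellK; lra.
Qed.

Lemma am_K (q : R) : 0 <= q < 1 -> am (ellK q) q = pi / 2.
Proof. exact: am_ellF. Qed.

Lemma am_NK (q : R) : 0 <= q < 1 -> am (- ellK q) q = - (pi / 2).
Proof. by move=> hq; rewrite /ellK -ellFN// am_ellF. Qed.

Lemma cn_gt0 q u : 0 <= q < 1 -> - ellK q < u < ellK q -> 0 < cn u q.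
Proof.
move=> hq /andP[h1 h2]; apply: cos_gt0_pihalf.
have := am_lt hq h1; have := am_lt hq h2; rewrite am_K// am_NK// => -> ->.
by [].
Qed.

Definition sn (u q : R) : R := sin (am u q).
Definition dn (u q : R) : R := delta q (am u q).

Lemma sn2cn2 u q : cn u q ^+ 2 = 1 - sn u q ^+ 2.
Proof. by rewrite /cn /sn -(cos2Dsin2 (am u q)); ring. Qed.

Lemma dn2E u q : 0 <= q < 1 -> dn u q ^+ 2 = 1 - q ^+ 2 * sn u q ^+ 2.
Proof. by move=> hq; rewrite /dn delta_sqr. Qed.

Lemma derive_sn q u : 0 <= q < 1 ->
  is_derive u (1 : R) (fun u => sn u q) (cn u q * dn u q).
Proof. by move=> hq; exact: der_comp (derive_am u hq) (is_derive_sin _). Qed.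

Lemma derive_cn q u : 0 <= q < 1 ->
  is_derive u (1 : R) (fun u => cn u q) (- sn u q * dn u q).
Proof. by move=> hq; exact: der_comp (derive_am u hq) (is_derive_cos _). Qed.

Lemma derive_dn q u : 0 <= q < 1 ->
  is_derive u (1 : R) (fun u => dn u q) (- q ^+ 2 * sn u q * cn u q).
Proof.
move=> hq; apply: is_derive_eqv (der_comp (derive_am u hq) (derive_delta _ hq)) _.
rewrite /sn /cn; have := delta_gt0 (am u q) hq => d0.
by field; rewrite gt_eqF.
Qed.

Lemma derive_ellE_am q u : 0 <= q < 1 ->
  is_derive u (1 : R) (fun u => ellE (am u q) q) (dn u q ^+ 2).
Proof. by move=> hq; rewrite expr2; exact: der_comp (derive_am u hq) (derive_ellE _ hq). Qed.

Lemma sn_period q u : 0 <= q < 1 -> sn (u + 4 * ellK q) q = sn u q.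
Proof. by move=> hq; rewrite /sn am_period// sinD2pi. Qed.

Lemma cn_period q u : 0 <= q < 1 -> cn (u + 4 * ellK q) q = cn u q.
Proof. by move=> hq; rewrite /cn am_period// cosD2pi. Qed.

Lemma dn_period q u : 0 <= q < 1 -> dn (u + 4 * ellK q) q = dn u q.
Proof. by move=> hq; rewrite /dn /delta /delta2 -!/(sn _ q) sn_period. Qed.

End jacobi.

(** * The functions 2 E - K and g of the modulus *)

Section modulus.
Context {R : realType}.
Notation mu := (@lebesgue_measure R).
Implicit Types p q x : R.

(** Up to the factor 4 / l and a sign, this is alpha for all three curves. *)
Definition ellM (q : R) : R := 2 * ellEc q - ellK q.

Lemma pihalf_ge0 : (0 : R) <= pi / 2.
Proof. by rewrite divr_ge0// pi_ge0. Qed.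

Lemma derive_ellM_aux q x : 0 <= q < 1 ->
  is_derive x (1 : R) (fun y => 2 * ellE y q + - ellF y q) (2 * delta q x - (delta q x)^-1).
Proof.
move=> hq; apply: is_derive_eqv (derD (derM (der_cst 2 x) (derive_ellE x hq)) (derN (derive_ellF x hq))) _.
by rewrite mul0r add0r.
Qed.

Lemma delta_le p q x : 0 <= p -> p <= q -> q < 1 -> delta q x <= delta p x.
Proof.
move=> p0 pq q1; rewrite ler_sqrt; last by apply/ltW/delta2_gt0; rewrite p0 (le_lt_trans pq).
rewrite /delta2 lerD2l lerN2 ler_wpM2r ?sqr_ge0//; nra.
Qed.

(** The comparison takes place under the integral: at fixed x, [delta] decreases with the modulus,
    hence so does 2 [delta] - 1 / [delta]. *)
Lemma ellM_le p q : 0 <= p -> p <= q -> q < 1 -> ellM q <= ellM p.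
Proof.
move=> p0 pq q1.
have hq : 0 <= q < 1 by rewrite (le_trans p0).
have hp : 0 <= p < 1 by rewrite p0 (le_lt_trans pq).
have d z (_ : 0 <= z <= pi / 2) := derD (derive_ellM_aux z hp) (derN (derive_ellM_aux z hq)).
have := derive_ge0_le pihalf_ge0 d; rewrite /ellM /ellEc /ellK /ellE /ellF !oint0.
set P := (X in (X -> _) -> _); suff h : P by move=> /(_ h); lra.
move=> z _; have h1 := delta_le z p0 pq q1.
have h2 : (delta p z)^-1 <= (delta q z)^-1 by rewrite lef_pV2// posrE delta_gt0.
lra.
Qed.

(** With m = [delta q0 (pi / 2)] = sqrt(1 - q0^2), a lower bound of [delta] for moduli up to q0, the
    two values a >= b of [delta] satisfy a^2 - b^2 <= 2 (q - p) and a + b >= 2 m. So a - b <= (q -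
    p) / m and 1 / b - 1 / a <= (q - p) / m^3; integration over [0, pi / 2] gives the factor pi /
    2. *)
Lemma ellM_lip p q q0 : 0 <= p -> p <= q -> q <= q0 -> q0 < 1 ->
  ellM p - ellM q <= (2 / delta q0 (pi / 2) + (delta q0 (pi / 2)) ^- 3) * (pi / 2) * (q - p).
Proof.
move=> p0 pq qq0 q01.
have hq : 0 <= q < 1 by rewrite (le_trans p0)// (le_lt_trans qq0).
have hp : 0 <= p < 1 by rewrite p0 (le_lt_trans (le_trans pq qq0)).
have hq0 : 0 <= q0 < 1 by rewrite (le_trans p0 (le_trans pq qq0)).
set m := delta q0 (pi / 2); have m0 : 0 < m by exact: delta_gt0.
have md r x : 0 <= r -> r <= q0 -> m <= delta r x.
  move=> r0 rq0; rewrite ler_sqrt; last by apply/ltW/delta2_gt0; rewrite r0 (le_lt_trans rq0).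
  apply: le_trans (delta2_ge r x); rewrite /delta2 sin_pihalf expr1n mulr1 lerD2l lerN2; nra.
pose c := 2 / m + m ^- 3.
have d z (_ : 0 <= z <= pi / 2) := derD (derM (der_cst (c * (q - p)) z) (der_id z))
   (derN (derD (derive_ellM_aux z hp) (derN (derive_ellM_aux z hq)))).
have := derive_ge0_le pihalf_ge0 d; rewrite /ellM /ellEc /ellK /ellE /ellF !oint0.
set P := (X in (X -> _) -> _); suff h : P by move=> /(_ h); rewrite -/c; lra.
move=> z _; set a := delta p z; set b := delta q z.
have a0 : m <= a by apply: md => //; exact: le_trans qq0.
have b0 : m <= b by apply: md => //; exact: le_trans pq.
have a1 : a <= 1 := delta_le1 p z.
have ab : b <= a by apply: delta_le => //; case/andP: hq.
have e : a ^+ 2 - b ^+ 2 = (q ^+ 2 - p ^+ 2) * sin z ^+ 2.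
  by rewrite /a /b !delta_sqr// /delta2; ring.
have h1 : m * (a - b) <= q - p.
  have s1 := sin2_le1 z; have s0 := sqr_ge0 (sin z).
  have : a ^+ 2 - b ^+ 2 <= 2 * (q - p).
    rewrite e; apply: (@le_trans _ _ ((q ^+ 2 - p ^+ 2) * 1)); last by nra.
    rewrite ler_wpM2l//; nra.
  nra.
have h2 : a - b <= (q - p) / m by rewrite ler_pdivlMr// mulrC.
have h3 : b^-1 - a^-1 <= (q - p) * m ^- 3.
  have a0' : 0 < a by exact: lt_le_trans a0.
  have b0' : 0 < b by exact: lt_le_trans b0.
  have -> : b^-1 - a^-1 = (a - b) * (a * b)^-1 by field; rewrite !gt_eqF.
  have -> : (q - p) * m ^- 3 = ((q - p) / m) * (m * m)^-1 by field; rewrite gt_eqF.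
  apply: ler_pM => //; first by rewrite subr_ge0.
    by rewrite invr_ge0 mulr_ge0 ?ltW.
  rewrite lef_pV2 ?posrE ?mulr_gt0//; exact: ler_pM (ltW m0) (ltW m0) a0 b0.
have -> : 0 * z + c * (q - p) * 1 - (2 * a - a^-1 - (2 * b - b^-1))
  = 2 * ((q - p) / m - (a - b)) + ((q - p) * m ^- 3 - (b^-1 - a^-1)).
  by rewrite /c; ring.
lra.
Qed.

(** The Lipschitz constant blows up as q0 tends to 1, hence the truncation to [0, q0]. *)
Lemma continuous_ellM q0 : 0 <= q0 -> q0 < 1 -> continuous (fun q => ellM (clamp 0 q0 q)).
Proof.
move=> q00 q01; apply: (@lipschitz_continuous _ _
  ((2 / delta q0 (pi / 2) + (delta q0 (pi / 2)) ^- 3) * (pi / 2))) => x y.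
wlog xy : x y / x <= y => [H|].
  by have [/H//|/ltW/H] := leP x y; rewrite distrC (distrC x).
have /andP[x0 x1] := clamp_itv x q00; have /andP[y0 y1] := clamp_itv y q00.
have xy' := clamp_mono q00 xy.
rewrite ger0_norm ?subr_ge0; last by apply: ellM_le => //; exact: le_lt_trans q01.
apply: le_trans (ellM_lip x0 xy' y1 q01) _; rewrite ler_wpM2l//.
  have m0 : 0 < delta q0 (pi / 2) by apply: delta_gt0; rewrite q00.
  have m0' := ltW m0.
  by rewrite mulr_ge0 ?pihalf_ge0// addr_ge0// ?divr_ge0// ?invr_ge0 ?exprn_ge0.
have := clamp_dist x y q00; rewrite distrC (distrC x) ger0_norm ?subr_ge0//.
Qed.

(** A general [h] serves both 2 E - K itself, for the existence of q_*, and [gfun], for the moduli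
    of the arcs. *)
Lemma ellM_IVT a b (h : R -> R -> R) c : 0 <= a -> a <= b -> b < 1 ->
  (forall q m : R -> R, continuous q -> continuous m -> continuous (fun x => h (m x) (q x))) ->
  h (ellM a) a <= c <= h (ellM b) b \/ h (ellM b) b <= c <= h (ellM a) a ->
  exists2 q, a <= q <= b & h (ellM q) q = c.
Proof.
move=> a0 ab b1 ch hc.
have b0 := le_trans a0 ab.
pose f q := h (ellM (clamp 0 b q)) q.
have fE q : 0 <= q <= b -> f q = h (ellM q) q by move=> hq; rewrite /f clamp_id.
have cf : continuous f by apply: ch; [move=> x; exact: cvg_id|exact: continuous_ellM].
have [||q + e] := @IVT _ f a b c ab; first exact: continuous_subspaceT.
  rewrite !fE ?a0 ?lexx ?b0 ?ab// ge_min le_max.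
  by case: hc => /andP[-> ->]; rewrite ?orbT.
rewrite in_itv/= => /andP[aq qb]; exists q; first by rewrite aq.
by rewrite -fE// (le_trans a0 aq).
Qed.

Lemma ellEc_ge0 q : 0 <= q < 1 -> 0 <= ellEc q.
Proof.
move=> hq; rewrite -(oint0 (delta q) 0).
by apply: derive_ge0_le pihalf_ge0 (fun z _ => derive_ellE z hq) _ => z _; rewrite ltW// delta_gt0.
Qed.

Lemma ellEc_le q : 0 <= q < 1 -> ellEc q <= pi / 2.
Proof.
move=> hq; have := derive_ge0_le pihalf_ge0 (fun z _ => derD (der_id z) (derN (derive_ellE z hq))).
rewrite /ellEc /ellE oint0; set P := (X in (X -> _) -> _); suff h : P by move=> /(_ h); lra.
by move=> z _; rewrite subr_ge0 delta_le1.
Qed.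

Lemma sin_le_id (x : R) : 0 <= x -> sin x <= x.
Proof.
move=> x0; have := derive_ge0_le x0 (fun z _ => derD (der_id z) (derN (is_derive_sin z))).
rewrite sin0; set P := (X in (X -> _) -> _); suff h : P by move=> /(_ h); lra.
by move=> z _; rewrite subr_ge0 cos_le1.
Qed.

(* The comparison 1 - q^2 sin^2 x <= (pi/2 - x + e)^2 with e^2 = 1 - q^2 shows
   that K(q) is at least ln((pi/2 + e) / e). *)
Lemma ellM_nonpos : exists2 q, 0 <= q < 1 & ellM q <= 0.
Proof.
(* For this [e] the logarithm is ln(pi / 2 + e) + 4 >= 4, whereas 2 E <= pi < 4. *)
pose e : R := expR (-4).
have e0 : 0 < e by exact: expR_gt0.
have e1 : e < 1 by rewrite -expR0 ltr_expR oppr_lt0.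
pose q := Num.sqrt (1 - e ^+ 2).
have q2 : q ^+ 2 = 1 - e ^+ 2 by rewrite sqr_sqrtr// subr_ge0 expr_le1// ltW.
have hq : 0 <= q < 1.
  rewrite sqrtr_ge0/= -[ltRHS]sqrtr1 ltr_sqrt// gtrBl exprn_gt0//.
exists q => //; have hE := ellEc_le hq; have := @pihalf_lt2 R => hp.
suff : 4 <= ellK q by rewrite /ellM; lra.
have dl z : 0 <= z <= pi / 2 ->
    is_derive z (1 : R) (fun x => ln (pi / 2 + e - x)) ((pi / 2 + e - z)^-1 * (0 - 1)).
  move=> hz; apply: (der_comp (derD (der_cst (pi / 2 + e) z) (derN (der_id z)))).
  by apply: is_derive1_ln; lra.
have := derive_ge0_le pihalf_ge0 (fun z hz => derD (derive_ellF z hq) (dl z hz)).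
rewrite ellF0 -/(ellK q) subr0.
set P := (X in (X -> _) -> _); suff h : P.
  move=> /(_ h); rewrite add0r addrAC subrr add0r /e expRK => h1.
  have : 0 <= ln (pi / 2 + expR (-4) : R) by apply: ln_ge0; have := @pihalf_ge1 R; rewrite -/e; lra.
  lra.
move=> z hz; rewrite sub0r mulrN1 subr_ge0 lef_pV2 ?posrE ?delta_gt0//; last by lra.
have -> : pi / 2 + e - z = Num.sqrt ((pi / 2 + e - z) ^+ 2) by rewrite sqrtr_sqr ger0_norm//; lra.
rewrite ler_sqrt ?sqr_ge0//.
(* Here 1 - q^2 sin^2 z = cos^2 z + e^2 sin^2 z <= (cos z + e)^2, so it remains to bound the
   cosine. *)
have c1 : cos z <= pi / 2 - z.
  have -> : cos z = sin (pi / 2 - z).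
    by rewrite -[LHS]opprK -sinBpihalf -sinN opprB.
  by apply: sin_le_id; lra.
have c0 : 0 <= cos z by apply: cos_ge0_pihalf; lra.
have := cos2Dsin2 z; have := sin2_le1 z; have := sqr_ge0 (sin z); rewrite /delta2 q2.
nra.
Qed.

(** Excludes zeros of [fpoly] where 2 E <= K, so that 2 E - K is positive at [qhat]. With a = q^2,
    the coefficient of K is -(4 a - 1)(1 - a) < 0; if the coefficient of E is negative, both terms
    have the right sign. *)
Lemma fpoly_lt0 q : 2^-1 < q ^+ 2 -> 0 <= q < 1 -> ellM q <= 0 -> fpoly q < 0.
Proof.
move=> q2 hq M0; have K0 := ellK_gt0 hq; have E0 := ellEc_ge0 hq.
have a1 : q ^+ 2 < 1 by nra.
rewrite /ellM in M0; rewrite /fpoly.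
have -> : q ^+ 4 = (q ^+ 2) ^+ 2 by rewrite -exprM.
move: (q ^+ 2) (ellK q) (ellEc q) => a K E in q2 K0 E0 a1 M0 *.
have h1 : (4 * a ^+ 2 - 5 * a + 1) * K < 0.
  have -> : 4 * a ^+ 2 - 5 * a + 1 = - ((4 * a - 1) * (1 - a)) by ring.
  by rewrite mulNr oppr_lt0 !mulr_gt0//; lra.
(* When the coefficient of E is nonnegative, replacing E by K / 2 leaves (1 / 2 - a) K, negative
   because a > 1 / 2. *)
have [c0|c0] := leP 0 (- 8 * a ^+ 2 + 8 * a - 1); last by nra.
have : (- 8 * a ^+ 2 + 8 * a - 1) * (2 * E) <= (- 8 * a ^+ 2 + 8 * a - 1) * K.
  by rewrite ler_wpM2l//; lra.
nra.
Qed.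

End modulus.

(** * First variation of the shifted elastica *)

Section first_variation.
Context {R : realType}.
Implicit Types (x y a b : R).

Lemma normD_le x y a b : `|x| <= a -> `|y| <= b -> `|x + y| <= a + b.
Proof. by move=> xa yb; apply: le_trans (ler_normD _ _) _; exact: lerD. Qed.

Lemma normM_le x y a b : `|x| <= a -> `|y| <= b -> `|x * y| <= a * b.
Proof. by move=> xa yb; rewrite normrM ler_pM. Qed.

Lemma normN_le x a : `|x| <= a -> `|- x| <= a.
Proof. by rewrite normrN. Qed.

Lemma norm_nat_le n : `|n%:R : R| <= n%:R.
Proof. by rewrite ger0_norm. Qed.

Lemma sqrt1D_le x : -1 <= x -> Num.sqrt (1 + x) <= 1 + x / 2.
Proof.
move=> hx; have h : 0 <= 1 + x / 2 by lra.
rewrite -[leRHS]ger0_norm// -sqrtr_sqr ler_sqrt ?sqr_ge0//.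
have := sqr_ge0 x; nra.
Qed.

(** Since N^2 = 1 + x and N <= 1 + x / 2, also N >= (1 + x) / (1 + x / 2). Inserting this in N^5 =
    (1 + x)^2 N reduces the claim to a polynomial inequality, for which 16 is a generous quadratic
    coefficient on |x| <= 1 / 4. *)
Lemma sqrt1D_expN5_le x : - (4^-1) <= x <= 4^-1 ->
  (Num.sqrt (1 + x) ^+ 5)^-1 <= 1 - 5 / 2 * x + 16 * x ^+ 2.
Proof.
move=> hx; set N := Num.sqrt (1 + x).
have N0 : 0 < N by rewrite sqrtr_gt0; lra.
have N2 : N ^+ 2 = 1 + x by rewrite sqr_sqrtr//; lra.
have NE : N <= 1 + x / 2 by apply: sqrt1D_le; lra.
rewrite -div1r ler_pdivrMr ?exprn_gt0//.
have -> : N ^+ 5 = (1 + x) ^+ 2 * N by rewrite -N2; ring.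
set p := 1 - _ + _.
have p0 : 0 < p by rewrite /p; nra.
have N1 : 1 + x <= N * (1 + x / 2) by rewrite -N2 expr2 ler_pM2l.
have key : 1 + x / 2 <= p * (1 + x) ^+ 3.
  have -> : p * (1 + x) ^+ 3 = 1 + x / 2 +
     x ^+ 2 * (23 / 2 + 83 / 2 * x + 91 / 2 * x ^+ 2 + 16 * x ^+ 3) by rewrite /p; field.
  rewrite lerDl mulr_ge0 ?sqr_ge0//.
  have -> : 16 * x ^+ 3 = x ^+ 2 * (16 * x) by ring.
  nra.
have h0 : 0 < 1 + x / 2 by lra.
rewrite -(ler_pM2r h0) mul1r; apply: le_trans key _.
have -> : p * (1 + x) ^+ 3 = p * (1 + x) ^+ 2 * (1 + x) by ring.
have -> : p * ((1 + x) ^+ 2 * N) * (1 + x / 2) = p * (1 + x) ^+ 2 * (N * (1 + x / 2)) by ring.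
by rewrite ler_pM2l// mulr_gt0// exprn_gt0//; lra.
Qed.

Ltac bound_norm :=
  repeat first [ eassumption | apply: norm_nat_le | exact: (norm_nat_le 1)
               | apply: normN_le | apply: normD_le | apply: normM_le ].

(** For T + t eta' and k N + t eta'', the letters stand for n = N . eta'', w = T . eta', v =
    |eta'|^2 / 2 and d = eta' x eta''; then 1 + x is the squared speed and the expression squared is
    the cross product. The point is that C depends on the bounds only. *)
Lemma energy_density_expansion (W lam : R) : 0 <= lam -> exists C : R,
  forall t k n w v d : R, `|t| <= 1 -> `|k| <= W -> `|n| <= W -> `|w| <= W ->
   `|v| <= W -> `|d| <= W ->
   let x := 2 * t * (w + t * v) in - (4^-1) <= x <= 4^-1 ->
   (k + t * (n + k * w) + t ^+ 2 * d) ^+ 2 / Num.sqrt (1 + x) ^+ 5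
     + lam * Num.sqrt (1 + x)
   <= k ^+ 2 + lam + t * (2 * k * n + (lam - 3 * k ^+ 2) * w) + C * t ^+ 2.
Proof.
move=> lam0.
(* [r] and [q] collect the terms of order t^2 and higher in the squared cross product and in the
   bound for speed^(-5) (64 is 16 times the 4 of x^2 = 4 t^2 y^2); the bounded quantity is then the
   whole remainder divided by t^2. *)
have [C HC] : exists C : R, forall t k n w v d : R, `|t| <= 1 -> `|k| <= W -> `|n| <= W -> `|w| <= W ->
   `|v| <= W -> `|d| <= W ->
   let m := n + k * w in let y := w + t * v in
   let r := m * m + 2 * k * d + 2 * t * m * d + t * t * d * d in
   let q := 64 * (y * y) + - (5 * v) in
  `| r + - (10 * k * m * w) + k * k * q + t * (2 * k * m * q + - (5 * w * r))
     + t * t * r * q + lam * v| <= C.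
  have lamW : `|lam| <= lam by rewrite ger0_norm.
  (* The constant is an existential variable, filled in by following the polynomial and replacing
     each factor by its bound; it cannot depend on the variables introduced after it. *)
  eexists => t k n w v d ht hk hn hw hv hd /=.
  by bound_norm.
exists C => t k n w v d ht hk hn hw hv hd x hx.
have := HC t k n w v d ht hk hn hw hv hd; cbv zeta; move/(le_trans (ler_norm _)).
set m := n + k * w; set y := w + t * v; set r := m * m + _ + _ + _; set q := 64 * _ + _.
set S := (_ + lam * v) => HS.
have h1 := sqrt1D_expN5_le hx.
have h2 : Num.sqrt (1 + x) <= 1 + x / 2 by apply: sqrt1D_le; lra.
have h3 := ler_wpM2l lam0 h2.
have h4 := ler_wpM2l (sqr_ge0 (k + t * m + t ^+ 2 * d)) h1.
have h5 := ler_wpM2r (sqr_ge0 t) HS.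
apply: le_trans (lerD h4 h3) _; apply: le_trans (lerD (lexx _) h5).
rewrite -subr_ge0; set z := (X in 0 <= X); suff -> : z = 0 by [].
by rewrite /z /S /r /q /y /x /m; field.
Qed.

Lemma normr_cos_le1 x : `|cos x| <= 1.
Proof. by rewrite ler_norml cos_geN1 cos_le1. Qed.

Lemma normr_sin_le1 x : `|sin x| <= 1.
Proof. by rewrite ler_norml sin_geN1 sin_le1. Qed.

(* The elastica equation is encoded by its first integral: with N = (- T2, T1),
   the vector 2 k' N + (k^2 - lam) T is the constant (P1, P2). *)
Record periodic_elastica (lam L M P1 P2 : R) (X1 X2 T1 T2 k k1 : R -> R) : Prop := {
  pe_X1 : forall s, is_derive s (1 : R) X1 (T1 s);
  pe_X2 : forall s, is_derive s (1 : R) X2 (T2 s);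
  pe_T1 : forall s, is_derive s (1 : R) T1 (- (k s * T2 s));
  pe_T2 : forall s, is_derive s (1 : R) T2 (k s * T1 s);
  pe_k : forall s, is_derive s (1 : R) k (k1 s);
  pe_unit : forall s, T1 s ^+ 2 + T2 s ^+ 2 = 1;
  pe_kM : forall s, `|k s| <= M;
  pe_k1M : forall s, `|k1 s| <= M;
  pe_T1L : forall s, T1 (s + L) = T1 s;
  pe_T2L : forall s, T2 (s + L) = T2 s;
  pe_kL : forall s, k (s + L) = k s;
  pe_knz : forall r, 0 < r -> exists2 e, 0 < e < r & k e != 0;
  pe_cons1 : forall s, - (2 * k1 s * T2 s) + (k s ^+ 2 - lam) * T1 s = P1;
  pe_cons2 : forall s, 2 * k1 s * T1 s + (k s ^+ 2 - lam) * T2 s = P2 }.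

(** [b] majorizes the energy density and [B] is an antiderivative of it, so the energy is at most B
    L - B 0. Speed need not be 1, hence the general density. *)
Record competitor (lam L rho : R) (X1 X2 T1 T2 k : R -> R)
    (Z1 Z2 Y1 Y2 V1 V2 b B : R -> R) : Prop := {
  cp_Z1 : forall s, is_derive s (1 : R) Z1 (Y1 s);
  cp_Z2 : forall s, is_derive s (1 : R) Z2 (Y2 s);
  cp_Y1 : forall s, is_derive s (1 : R) Y1 (V1 s);
  cp_Y2 : forall s, is_derive s (1 : R) Y2 (V2 s);
  cp_V1 : continuous V1;
  cp_V2 : continuous V2;
  cp_Z10 : Z1 0 = 0;
  cp_Z20 : Z2 0 = 0;
  cp_Z1L : Z1 L = X1 L;
  cp_Z2L : Z2 L = X2 L;
  cp_near0 : forall s, `|X1 s - Z1 s| <= rho /\ `|X2 s - Z2 s| <= rho;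
  cp_near1 : forall s, `|T1 s - Y1 s| <= rho /\ `|T2 s - Y2 s| <= rho;
  cp_near2 : forall s, `|- (k s * T2 s) - V1 s| <= rho /\ `|k s * T1 s - V2 s| <= rho;
  cp_Ynz : forall s, 0 < Y1 s ^+ 2 + Y2 s ^+ 2;
  cp_b : continuous b;
  cp_B : forall s, is_derive s (1 : R) B (b s);
  cp_density : forall s, (Y1 s * V2 s - Y2 s * V1 s) ^+ 2 / Num.sqrt (Y1 s ^+ 2 + Y2 s ^+ 2) ^+ 5
      + lam * Num.sqrt (Y1 s ^+ 2 + Y2 s ^+ 2) <= b s;
  cp_lt : B L - B 0 < oint 0 L (fun s => k s ^+ 2 + lam) }.

End first_variation.

(** * Construction of the energy-lowering curve *)

Section competitor.
Context {R : realType}.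
Context (lam L M P1 P2 : R) (X1 X2 T1 T2 k k1 : R -> R).
Context (PE : periodic_elastica lam L M P1 P2 X1 X2 T1 T2 k k1).
Context (lam0 : 0 < lam) (L0 : 0 < L).

Let dX1 := pe_X1 PE. Let dX2 := pe_X2 PE. Let dT1 := pe_T1 PE. Let dT2 := pe_T2 PE.
Let dk := pe_k PE.

Lemma pe_normT1 s : `|T1 s| <= 1.
Proof. by have := pe_unit PE s; have := sqr_ge0 (T2 s); rewrite ler_norml; nra. Qed.

Lemma pe_normT2 s : `|T2 s| <= 1.
Proof. by have := pe_unit PE s; have := sqr_ge0 (T1 s); rewrite ler_norml; nra. Qed.

Lemma pe_M0 : 0 <= M.
Proof. exact: le_trans (normr_ge0 _) (pe_kM PE 0). Qed.

Lemma shift_bound (f f' : R -> R) C e s : (forall z, is_derive z (1 : R) f (f' z)) ->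
  (forall z, `|f' z| <= C) -> 0 <= e -> `|f (s + e) - f s| <= C * e.
Proof.
move=> df fC e0; have := derive_bound s (s + e) df fC.
have -> : s + e - s = e by ring.
by rewrite (ger0_norm e0).
Qed.

Lemma derive_shift (f f' : R -> R) e : (forall z, is_derive z (1 : R) f (f' z)) ->
  forall z, is_derive z (1 : R) (fun s => f (s + e)) (f' (z + e)).
Proof.
move=> df z; apply: is_derive_eqv (der_comp (derD (der_id z) (der_cst e z)) (df _)) _.
by rewrite addr0 mulr1.
Qed.

Lemma pe_kc : continuous k.
Proof. exact: continuous_of_derive dk. Qed.

Lemma pe_K1 s : is_derive s (1 : R) (fun s => - (k s * T2 s))
  (- (k1 s * T2 s + k s * (k s * T1 s))).
Proof. exact: derN (derM (dk s) (dT2 s)). Qed.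

Lemma pe_K2 s : is_derive s (1 : R) (fun s => k s * T1 s)
  (k1 s * T1 s + k s * - (k s * T2 s)).
Proof. exact: derM (dk s) (dT1 s). Qed.

(** The slopes are at most 2 for positions (the curve and its base point both move), M for tangents
    and M + M^2 for second derivatives; [C] dominates all three. *)
Lemma pe_shift_near e s : 0 <= e -> X1 0 = 0 -> X2 0 = 0 ->
  let C := 2 + M + M * M in
  [/\ `|X1 (s + e) - X1 e - X1 s| <= C * e /\ `|X2 (s + e) - X2 e - X2 s| <= C * e,
   `|T1 (s + e) - T1 s| <= C * e /\ `|T2 (s + e) - T2 s| <= C * e &
   `|- (k (s + e) * T2 (s + e)) - - (k s * T2 s)| <= C * e /\
   `|k (s + e) * T1 (s + e) - k s * T1 s| <= C * e].
Proof.
move=> e0 X10 X20 /=; have M0 := pe_M0; have MM0 : 0 <= M * M by exact: mulr_ge0.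
have hk := pe_kM PE; have hk1 := pe_k1M PE.
have X_near (X T : R -> R) : (forall z, is_derive z (1 : R) X (T z)) -> X 0 = 0 -> (forall z, `|T z| <= 1) ->
    `|X (s + e) - X e - X s| <= (2 + M + M * M) * e.
  move=> dX X0 T1le; have h1 := shift_bound s dX T1le e0; have h2 := shift_bound 0 dX T1le e0.
  rewrite add0r X0 subr0 in h2.
  rewrite addrAC; apply: le_trans (ler_normB _ _) _; apply: le_trans (lerD h1 h2) _.
  by rewrite -mulrDl ler_wpM2r//; lra.
have le_C C : C <= 2 + M + M * M -> C * e <= (2 + M + M * M) * e.
  by move=> h; rewrite ler_wpM2r.
have bT1 := pe_normT1; have bT2 := pe_normT2.
split; split.
- exact: X_near dX1 X10 bT1.
- exact: X_near dX2 X20 bT2.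
- apply: le_trans (shift_bound (C := M * 1) s dT1 _ e0) _; last by apply: le_C; lra.
  by move=> z; apply: normN_le; apply: normM_le.
- apply: le_trans (shift_bound (C := M * 1) s dT2 _ e0) _; last by apply: le_C; lra.
  by move=> z; apply: normM_le.
- apply: le_trans (shift_bound (C := M * 1 + M * (M * 1)) s pe_K1 _ e0) _; last by apply: le_C; lra.
  by move=> z; apply: normN_le; apply: normD_le; apply: normM_le => //; apply: normM_le.
- apply: le_trans (shift_bound (C := M * 1 + M * (M * 1)) s pe_K2 _ e0) _; last by apply: le_C; lra.
  by move=> z; apply: normD_le; apply: normM_le => //; apply: normN_le; apply: normM_le.
Qed.

Let Q s := oint 0 s (fun s => k s ^+ 2 + lam).

Lemma continuous_density0 : continuous (fun s => k s ^+ 2 + lam).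
Proof.
apply: (@continuous_of_derive _ _ (fun s => 2 * k s * k1 s + 0)) => s.
by apply: derD (der_cst _ _); exact: (derX 2 (dk s)).
Qed.

(** The density is L-periodic, so its integral over a period does not depend on the starting
    point. *)
Lemma pe_energy_shift e : Q (L + e) - Q e = Q L.
Proof.
have dQ s : is_derive s (1 : R) Q (k s ^+ 2 + lam) by exact: derive_oint continuous_density0.
have dQL s : is_derive s (1 : R) (fun s => Q (s + L)) (k s ^+ 2 + lam).
  by have := derive_shift L dQ s; rewrite (pe_kL PE).
have := eq_deriv e 0 dQL dQ; rewrite add0r [e + L]addrC {4}/Q oint0; lra.
Qed.

Lemma exists_pos_below (a b c d : R) : 0 < a -> 0 < b -> 0 < c -> 0 < d ->
  exists2 t, 0 < t & [/\ t <= a, t <= b, t <= c & t <= d].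
Proof.
move=> a0 b0 c0 d0; exists (Num.min (Num.min a b) (Num.min c d)).
  by rewrite !lt_min a0 b0 c0 d0.
by rewrite !ge_min !lexx !orbT.
Qed.

(* The full-period shift X(. + e) - X e has the energy of X but nonzero end
   curvature; moving it along sin (pi s / L) v, with v = 2 k N at the end
   points, changes the energy by - 2 (pi / L) |v|^2 to first order. *)
Lemma exists_competitor rho : 0 < rho -> X1 0 = 0 -> X2 0 = 0 ->
  exists Z1 Z2 Y1 Y2 V1 V2 b B : R -> R,
    competitor lam L rho X1 X2 T1 T2 k Z1 Z2 Y1 Y2 V1 V2 b B.
Proof.
move=> rho0 X10 X20.
have M0 := pe_M0; have MM0 : 0 <= M * M by exact: mulr_ge0.
have hk := pe_kM PE; have hT1 := pe_normT1; have hT2 := pe_normT2.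
pose C0 := 2 + M + M * M; have C00 : 0 < C0 by rewrite /C0; lra.
(* The shift may use half of [rho]; the other half is left for the perturbation. *)
have [e /andP[e0 er] ke] := pe_knz PE (divr_gt0 rho0 (mulr_gt0 (ltr0n _ 2) C00)).
have {}er : C0 * e <= rho / 2.
  have := ltW er; rewrite ler_pdivlMr ?mulr_gt0//; lra.
pose om := pi / L; have om0 : 0 < om by rewrite divr_gt0// pi_gt0.
have omL : om * L = pi by rewrite /om divfK// gt_eqF.
pose v1 := - (2 * k e * T2 e); pose v2 := 2 * k e * T1 e.
have vv : v1 ^+ 2 + v2 ^+ 2 = 4 * k e ^+ 2.
  by rewrite /v1 /v2 -[RHS]mulr1 -[X in _ = _ * X](pe_unit PE e); ring.
have vv0 : 0 < v1 ^+ 2 + v2 ^+ 2.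
  by rewrite vv mulr_gt0// lt_neqAle sqr_ge0 andbT eq_sym sqrf_eq0.
have v1M : `|v1| <= 2 * M * 1 by apply: normN_le; do 2 (apply: normM_le => //); exact: norm_nat_le.
have v2M : `|v2| <= 2 * M * 1 by do 2 (apply: normM_le => //); exact: norm_nat_le.
pose D := (1 + om + om * om) * (2 * M * 1).
have oo0 : 0 <= om * om by rewrite mulr_ge0// ltW.
have D0 : 0 <= D by apply: mulr_ge0; lra.
have DE c f v : `|f| <= 1 -> `|v| <= 2 * M * 1 -> 0 <= c -> c <= 1 + om + om * om ->
    `|c * f * v| <= D.
  move=> f1 vM c0 c1; rewrite /D -[1 + om + _]mulr1; apply: normM_le => //.
  by apply: normM_le => //; rewrite ger0_norm.
pose eta v s := sin (om * s) * v.
pose eta' v s := om * cos (om * s) * v.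
pose eta'' v s := - (om * om * sin (om * s) * v).
have hE v s : `|v| <= 2 * M * 1 -> `|eta v s| <= D.
  by move=> hv; rewrite /eta -[sin _]mul1r; apply: DE => //; [exact: normr_sin_le1|lra].
have hE' v s : `|v| <= 2 * M * 1 -> `|eta' v s| <= D.
  by move=> hv; apply: DE => //; [exact: normr_cos_le1|exact: ltW|lra].
have hE'' v s : `|v| <= 2 * M * 1 -> `|eta'' v s| <= D.
  by move=> hv; apply: normN_le; apply: DE => //; [exact: normr_sin_le1|lra].
have dom s : is_derive s (1 : R) (fun s => om * s) om.
  by apply: is_derive_eqv (derM (der_cst om s) (der_id s)) _; ring.
have dE v s : is_derive s (1 : R) (eta v) (eta' v s).
  apply: is_derive_eqv (derM (der_comp (dom s) (is_derive_sin _)) (der_cst v s)) _.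
  by rewrite /eta'; ring.
have dE' v s : is_derive s (1 : R) (eta' v) (eta'' v s).
  apply: is_derive_eqv (derM (derM (der_cst om s) (der_comp (dom s) (is_derive_cos _))) (der_cst v s)) _.
  by rewrite /eta''; ring.
have cE'' v : continuous (eta'' v).
  move=> s; exact: is_derive_continuous (derN (derM (derM (der_cst (om * om) s)
    (der_comp (dom s) (is_derive_sin _))) (der_cst v s))).
pose W := M + 2 * D + 2 * D * D; have DD0 : 0 <= D * D by exact: mulr_ge0.
have W0 : 0 <= W by rewrite /W; lra.
have [C HC] := energy_density_expansion W (ltW lam0).
(* The four bounds serve, in order, the density expansion, the other half of [rho], the restriction
   of x to [-1/4, 1/4], and the dominance of the linear gain over the error C t^2 L. *)
have [t t0 [t1 tD tW tC]] : exists2 t, 0 < t & [/\ t <= 1, t <= rho / 2 / (D + 1),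
    t <= (16 * (W + 1))^-1 & t <= om * (v1 ^+ 2 + v2 ^+ 2) / ((`|C| + 1) * L)].
  have [D1 W1] : 0 < D + 1 /\ 0 < W + 1 by lra.
  have C1 : 0 < `|C| + 1 by rewrite ltr_wpDl.
  apply: exists_pos_below; first exact: ltr01.
  - by rewrite !divr_gt0.
  - by rewrite invr_gt0 mulr_gt0.
  - by apply: divr_gt0; apply: mulr_gt0.
have {}tD : t * D <= rho / 2.
  by move: tD; rewrite ler_pdivlMr; nra.
have {}tW : 16 * t * (W + 1) <= 1.
  move: tW; rewrite -[X in _ <= X]div1r ler_pdivlMr; lra.
have {}tC : C * t ^+ 2 * L < 2 * t * om * (v1 ^+ 2 + v2 ^+ 2).
  move: tC; rewrite ler_pdivlMr ?mulr_gt0 ?ltr_wpDl// => tC.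
  have := ler_norm C => CC.
  have : C * (t * L) <= `|C| * (t * L) by rewrite ler_wpM2r// mulr_ge0// ltW.
  have tL : 0 < t * L by exact: mulr_gt0.
  have ov : 0 < om * (v1 ^+ 2 + v2 ^+ 2) by exact: mulr_gt0.
  move=> h; have h2 : C * (t * L) < 2 * (om * (v1 ^+ 2 + v2 ^+ 2)) by nra.
  have := ltr_pM2l t0 (C * (t * L)) (2 * (om * (v1 ^+ 2 + v2 ^+ 2))); rewrite h2 => /esym.
  by rewrite (_ : t * (C * (t * L)) = C * t ^+ 2 * L); [rewrite (_ : t * _ = 2 * t * om * (v1 ^+ 2 + v2 ^+ 2)) //; ring|ring].
have tn : `|t| <= t by rewrite ger0_norm// ltW.
have near (x y z : R) : `|x - y| <= C0 * e -> `|z| <= D -> `|y - (x + t * z)| <= rho.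
  move=> h1 h2; rewrite (_ : y - _ = - (x - y) + - (t * z)); last by ring.
  apply: le_trans (normD_le (normN_le h1) (normN_le (normM_le tn h2))) _; lra.
pose w s := T1 (s + e) * eta' v1 s + T2 (s + e) * eta' v2 s.
pose n s := - (T2 (s + e) * eta'' v1 s) + T1 (s + e) * eta'' v2 s.
pose sp s := (eta' v1 s ^+ 2 + eta' v2 s ^+ 2) / 2.
pose d s := eta' v1 s * eta'' v2 s + - (eta' v2 s * eta'' v1 s).
pose b s := k (s + e) ^+ 2 + lam
   + t * (2 * k (s + e) * n s + (lam - 3 * k (s + e) ^+ 2) * w s) + C * t ^+ 2.
(* This is 2 k N . eta' - P . eta, with P the constant vector of the first integral. As N' = - k T,
   the terms in k' cancel and its derivative is exactly the linear term of [b]. At the ends eta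
   vanishes and eta' is om v and - om v. *)
pose Phi s := - (2 * k (s + e) * T2 (s + e)) * eta' v1 s + 2 * k (s + e) * T1 (s + e) * eta' v2 s
   + - (P1 * eta v1 s + P2 * eta v2 s).
pose B s := Q (s + e) + t * Phi s + C * t ^+ 2 * s.
have hx s : - (4^-1) <= 2 * t * (w s + t * sp s) <= 4^-1.
  have h1 : `|w s| <= 1 * D + 1 * D by apply: normD_le; apply: normM_le => //; exact: hE'.
  have h2 : `|sp s| <= D * D.
    rewrite ger0_norm; last by rewrite divr_ge0// addr_ge0// sqr_ge0.
    rewrite ler_pdivrMr// mulr_natr mulr2n; apply: lerD; rewrite -real_normK ?num_real// expr2;
      by apply: ler_pM => //; exact: hE'.
  have h3 : `|2 * t * (w s + t * sp s)| <= 2 * t * (1 * D + 1 * D + 1 * (D * D)).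
    apply: normM_le; first by rewrite ger0_norm// mulr_ge0// ltW.
    apply: normD_le => //; apply: normM_le => //; exact: le_trans tn t1.
  rewrite -ler_norml; apply: le_trans h3 _; rewrite /W in tW; nra.
have speed s : (T1 (s + e) + t * eta' v1 s) ^+ 2 + (T2 (s + e) + t * eta' v2 s) ^+ 2 =
    1 + 2 * t * (w s + t * sp s).
  by rewrite -[X in _ = X + _](pe_unit PE (s + e)) /w /sp; field.
have dk' := derive_shift e dk.
have dT1' := derive_shift e dT1. have dT2' := derive_shift e dT2.
exists (fun s => X1 (s + e) - X1 e + t * eta v1 s), (fun s => X2 (s + e) - X2 e + t * eta v2 s),
  (fun s => T1 (s + e) + t * eta' v1 s), (fun s => T2 (s + e) + t * eta' v2 s),
  (fun s => - (k (s + e) * T2 (s + e)) + t * eta'' v1 s),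
  (fun s => k (s + e) * T1 (s + e) + t * eta'' v2 s), b, B.
have dsum (f f' : R -> R) c g g' s : (forall s, is_derive s (1 : R) f (f' s)) ->
   is_derive s (1 : R) g g' ->
   is_derive s (1 : R) (fun s => f (s + e) - c + t * g s) (f' (s + e) + t * g').
  move=> df dg; apply: is_derive_eqv (derD (derD (derive_shift e df s) (derN (der_cst c s)))
    (derM (der_cst t s) dg)) _; ring.
have dsum0 (f f' : R -> R) g g' s : (forall s, is_derive s (1 : R) f (f' s)) ->
   is_derive s (1 : R) g g' ->
   is_derive s (1 : R) (fun s => f (s + e) + t * g s) (f' (s + e) + t * g').
  move=> df dg; apply: is_derive_eqv (derD (derive_shift e df s) (derM (der_cst t s) dg)) _; ring.
have csum (f f' : R -> R) g : (forall s, is_derive s (1 : R) f (f' s)) ->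
   continuous g -> continuous (fun s => f (s + e) + t * g s).
  move=> df cg s; apply: cvgD; first exact: is_derive_continuous (derive_shift e df s).
  by apply: cvgM; [exact: cvg_cst|exact: cg].
have eta0 v : eta v 0 = 0 by rewrite /eta mulr0 sin0 mul0r.
have etaL v : eta v L = 0 by rewrite /eta omL sinpi mul0r.
have X_L (X T : R -> R) : (forall s, is_derive s (1 : R) X (T s)) -> (forall s, T (s + L) = T s) ->
    X 0 = 0 -> X (L + e) - X e = X L.
  move=> dX TL X0; have dXL s : is_derive s (1 : R) (fun s => X (s + L)) (T s).
    by have := derive_shift L dX s; rewrite TL.
  have := eq_deriv e 0 dXL dX; rewrite add0r X0 [e + L]addrC; lra.
have e0' := ltW e0.
split.
- by move=> s; exact: dsum dX1 (dE v1 s).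
- by move=> s; exact: dsum dX2 (dE v2 s).
- by move=> s; exact: dsum0 dT1 (dE' v1 s).
- by move=> s; exact: dsum0 dT2 (dE' v2 s).
- exact: csum pe_K1 (cE'' v1).
- exact: csum pe_K2 (cE'' v2).
- by rewrite add0r subrr eta0 mulr0 addr0.
- by rewrite add0r subrr eta0 mulr0 addr0.
- by rewrite etaL mulr0 addr0 (X_L X1 T1 dX1 (pe_T1L PE) X10).
- by rewrite etaL mulr0 addr0 (X_L X2 T2 dX2 (pe_T2L PE) X20).
- move=> s; have [[h1 h2] _ _] := pe_shift_near s e0' X10 X20.
  by split; apply: near => //; exact: hE.
- move=> s; have [_ [h1 h2] _] := pe_shift_near s e0' X10 X20.
  by split; apply: near => //; exact: hE'.
- move=> s; have [_ _ [h1 h2]] := pe_shift_near s e0' X10 X20.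
  by split; apply: near => //; exact: hE''.
- by move=> s; rewrite speed; have := hx s; lra.
- have db (s : R) : {for s, continuous b}.
    have dw := derD (derM (dT1' s) (dE' v1 s)) (derM (dT2' s) (dE' v2 s)).
    have cn : {for s, continuous n}.
      apply: cvgD; first apply: cvgN.
        by apply: cvgM; [exact: is_derive_continuous (dT2' s)|exact: cE''].
      by apply: cvgM; [exact: is_derive_continuous (dT1' s)|exact: cE''].
    have dk2 := derX 2 (dk' s).
    apply: cvgD; last exact: cvg_cst.
    apply: cvgD; first by exact: is_derive_continuous (derD dk2 (der_cst lam s)).
    apply: cvgM; first exact: cvg_cst.
    apply: cvgD.
      apply: cvgM; last exact: cn.
      exact: is_derive_continuous (derM (der_cst 2 s) (dk' s)).
    exact: is_derive_continuous (derM (derD (der_cst lam s) (derN (derM (der_cst 3 s) dk2))) dw).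
  exact: db.
- move=> s.
  have dQ z : is_derive z (1 : R) Q (k z ^+ 2 + lam) by exact: derive_oint continuous_density0.
  have dA1 := derN (derM (derM (der_cst 2 s) (dk' s)) (dT2' s)).
  have dA2 := derM (derM (der_cst 2 s) (dk' s)) (dT1' s).
  have dPhi := derD (derD (derM dA1 (dE' v1 s)) (derM dA2 (dE' v2 s)))
    (derN (derD (derM (der_cst P1 s) (dE v1 s)) (derM (der_cst P2 s) (dE v2 s)))).
  apply: is_derive_eqv (derD (derD (derive_shift e dQ s) (derM (der_cst t s) dPhi))
    (derM (der_cst (C * t ^+ 2) s) (der_id s))) _.
  by rewrite /b /w /n -(pe_cons1 PE (s + e)) -(pe_cons2 PE (s + e)); ring.
- move=> s; rewrite speed.
  have -> : (T1 (s + e) + t * eta' v1 s) * (k (s + e) * T1 (s + e) + t * eta'' v2 s) -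
    (T2 (s + e) + t * eta' v2 s) * (- (k (s + e) * T2 (s + e)) + t * eta'' v1 s)
    = k (s + e) + t * (n s + k (s + e) * w s) + t ^+ 2 * d s.
    rewrite -[X in _ = X + _ + _]mulr1 -[X in _ = _ * X + _ + _](pe_unit PE (s + e)) /n /w /d; ring.
  apply: HC (hx s).
  + exact: le_trans tn t1.
  + by apply: le_trans (hk _) _; rewrite /W; lra.
  + apply: (@le_trans _ _ (1 * D + 1 * D)); last by rewrite /W; lra.
    by apply: normD_le; [apply: normN_le|]; apply: normM_le => //; exact: hE''.
  + apply: (@le_trans _ _ (1 * D + 1 * D)); last by rewrite /W; lra.
    by apply: normD_le; apply: normM_le => //; exact: hE'.
  + apply: (@le_trans _ _ ((D * D + D * D) * 2^-1)); last by rewrite /W; lra.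
    apply: normM_le; last by rewrite ger0_norm.
    by apply: normD_le; rewrite expr2; apply: normM_le; exact: hE'.
  + apply: (@le_trans _ _ (D * D + D * D)); last by rewrite /W; lra.
    by apply: normD_le; [|apply: normN_le]; apply: normM_le; [exact: hE'|exact: hE''|exact: hE'|exact: hE''].
- have PhiL : Phi L = - (om * (v1 ^+ 2 + v2 ^+ 2)).
    rewrite /Phi !etaL /eta' omL cospi [L + e]addrC (pe_kL PE) (pe_T1L PE) (pe_T2L PE) /v1 /v2; ring.
  have Phi0 : Phi 0 = om * (v1 ^+ 2 + v2 ^+ 2).
    by rewrite /Phi !eta0 /eta' mulr0 cos0 add0r /v1 /v2; ring.
  rewrite -/(Q L) -(pe_energy_shift e) /B PhiL Phi0 add0r; lra.
Qed.

End competitor.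

(** * Wavelike elasticae *)

Section moduli_choice.
Context {R : realType}.
Implicit Types q x lam l c : R.

Lemma continuous_gfun_aux (p m : R -> R) : continuous p -> continuous m ->
  continuous (fun x => 8 * m x ^+ 2 * (2 * p x ^+ 2 - 1)).
Proof.
move=> cp cm; apply: continuousRM.
  by apply: continuousRM; [exact: continuousR_cst|exact: continuousRX].
apply: continuousRD; last exact: continuousR_cst.
by apply: continuousRM; [exact: continuousR_cst|exact: continuousRX].
Qed.

Lemma gfun_IVT a b c : 0 <= a -> a <= b -> b < 1 ->
  gfun a <= c <= gfun b \/ gfun b <= c <= gfun a ->
  exists2 q, a <= q <= b & gfun q = c.
Proof.
move=> a0 ab b1 h.
exact: (@ellM_IVT _ a b (fun m p => 8 * m ^+ 2 * (2 * p ^+ 2 - 1)) c a0 ab b1 continuous_gfun_aux).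
Qed.

Lemma gfunE q : gfun q = 8 * ellM q ^+ 2 * (2 * q ^+ 2 - 1).
Proof. by []. Qed.

Lemma sqrt2V_gt0 : 0 < (Num.sqrt 2)^-1 :> R.
Proof. by rewrite invr_gt0 sqrtr_gt0. Qed.

Lemma sqrt2V_sqr : (Num.sqrt 2)^-1 ^+ 2 = 2^-1 :> R.
Proof. by rewrite exprVn sqr_sqrtr. Qed.

Lemma gfun_sqrt2V : gfun (Num.sqrt 2)^-1 = 0 :> R.
Proof. by rewrite gfunE sqrt2V_sqr divff ?subrr ?mulr0. Qed.

(** Positivity of g at [qhat] rules out the default value 0, where g = -8 (2 E - K)^2 <= 0, and also
    the end point 1 / sqrt 2, where g = 0. *)
Lemma qhat_spec c : 0 < c -> c <= @lambdahat R ->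
  [/\ (Num.sqrt 2)^-1 < @qhat R, @qhat R < 1 & 0 < ellM (@qhat R)].
Proof.
move=> c0 cl; have g0 : 0 < gfun (@qhat R) by exact: lt_le_trans cl.
have [/andP[q0 q1] fq] : (Num.sqrt 2)^-1 <= @qhat R < 1 /\ fpoly (@qhat R) = 0.
  move: g0; rewrite {1}/qhat; case: xgetP => [y -> [] //|_]; rewrite gfunE expr0n/= mulr0 sub0r => h.
  have := sqr_ge0 (ellM (0 : R)); lra.
have s0 := sqrt2V_gt0.
have q0' : (Num.sqrt 2)^-1 < @qhat R.
  rewrite lt_neqAle q0 andbT; apply/eqP => e; move: g0.
  by rewrite -e gfun_sqrt2V ltxx.
have hq : 0 <= @qhat R < 1 by rewrite (le_trans (ltW s0) q0).
have q2 : 2^-1 < (@qhat R) ^+ 2.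
  by rewrite -sqrt2V_sqr ltr_pXn2r// nnegrE ?ltW// (lt_trans s0).
split => //; rewrite ltNge; apply/negP => M0.
by have := fpoly_lt0 q2 hq M0; rewrite fq ltxx.
Qed.

Lemma q_sarc_spec lam l : 0 < lam -> 0 < l -> lam * l ^+ 2 <= 4 * lambdahat ->
  0 < q_sarc lam l < 1 /\ gfun (q_sarc lam l) = lam * l ^+ 2 / 4.
Proof.
move=> lam0 l0 h; set c := lam * l ^+ 2 / 4.
have c0 : 0 < c by rewrite /c !mulr_gt0 ?exprn_gt0.
have cl : c <= lambdahat by rewrite /c ler_pdivrMr// [_ * 4]mulrC.
have [q0 q1 _] := qhat_spec c0 cl; have s0 := sqrt2V_gt0.
rewrite /q_sarc -/c /Defs.q1; case: xgetP => [y -> [/andP[y0 y1] e]|].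
  by rewrite (lt_trans s0 y0) (le_lt_trans y1 q1).
have [|q /andP[a b] e] := @gfun_IVT _ _ c (ltW s0) (ltW q0) q1.
  by left; rewrite gfun_sqrt2V (ltW c0).
move=> /(_ q) []; split => //; rewrite b andbT lt_neqAle a andbT.
by apply/eqP => e'; move: e; rewrite -e' gfun_sqrt2V => e; rewrite -e ltxx in c0.
Qed.

(** At q = 0 both integrals equal pi / 2, so 2 E - K starts positive; the intermediate value theorem
    applies up to a modulus where it is nonpositive. *)
Lemma qstar_spec : 0 < @qstar R < 1 /\ ellM (@qstar R) = 0.
Proof.
rewrite /qstar; case: xgetP => [y -> //|]; have [q /andP[q0 q1] Mq] := @ellM_nonpos R.
have M0 : 0 < ellM (0 : R).
  have h0 : 0 <= (0 : R) < 1 by rewrite lexx/=.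
  have e : ellEc (0 : R) = ellK 0.
    by congr oint; apply/funext => x; rewrite expr0n/= mul0r subr0 sqrtr1 invr1.
  by rewrite /ellM e; have := ellK_gt0 h0; lra.
have [||q' /andP[a b] e] := @ellM_IVT _ 0 q (fun m _ => m) 0 (lexx 0) q0 q1.
- by move=> _ m _.
- by right; rewrite Mq ltW.
move=> /(_ q') []; split => //; rewrite (le_lt_trans b q1) andbT lt_neqAle a andbT.
by apply/eqP => e'; move: M0; rewrite -e' in e; rewrite e ltxx.
Qed.

Lemma q_larc_spec lam l : 0 < lam -> 0 < l -> lam * l ^+ 2 <= 4 * lambdahat ->
  0 < q_larc lam l < 1 /\ gfun (q_larc lam l) = lam * l ^+ 2 / 4.
Proof.
move=> lam0 l0 h; set c := lam * l ^+ 2 / 4.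
have c0 : 0 < c by rewrite /c !mulr_gt0 ?exprn_gt0.
have cl : c <= lambdahat by rewrite /c ler_pdivrMr// [_ * 4]mulrC.
have [q0 q1 M0] := qhat_spec c0 cl; have s0 := sqrt2V_gt0.
have [/andP[p0 p1] Mp] := qstar_spec; have h0 := lt_trans s0 q0.
(* 2 E - K decreases, is positive at [qhat] and vanishes at [qstar]; g then runs from [lambdahat]
   down to 0 between them. *)
have qp : @qhat R < @qstar R.
  rewrite ltNge; apply/negP => pq.
  by have := ellM_le (ltW p0) pq q1; rewrite Mp leNgt M0.
rewrite /q_larc -/c /q2; case: xgetP => [y -> [/andP[y0 y1] e]|].
  by rewrite (lt_le_trans h0 y0) (lt_trans y1 p1).
have gp : gfun (@qstar R) = 0 by rewrite gfunE Mp expr0n/= mulr0 mul0r.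
have [|q /andP[a b] e] := @gfun_IVT _ _ c (ltW h0) (ltW qp) p1.
  by right; rewrite gp (ltW c0).
move=> /(_ q) []; split => //; rewrite a/= lt_neqAle b andbT.
by apply/eqP => e'; move: e; rewrite e' gp => e; rewrite -e ltxx in c0.
Qed.

(** The default modulus is excluded here by the length instead of by the growth of g at 1: for q = 0
    one has E = K, so alpha = - 4 K / l and the length would be negative. *)
Lemma q_loop_spec lam l : 0 < l -> 0 < len_loop lam l ->
  0 < q_loop lam l < 1 /\ gfun (q_loop lam l) = lam * l ^+ 2 / 4.
Proof.
move=> l0; rewrite /len_loop /q_loop /q3; have [/andP[p0 _] _] := qstar_spec.
case: xgetP => [y -> [/andP[y0 y1] e] _|_]; first by rewrite (lt_trans p0 y0) y1.
have h0 : 0 <= (0 : R) < 1 by rewrite lexx/=.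
have e : ellEc (0 : R) = ellK 0.
  by congr oint; apply/funext => x; rewrite expr0n/= mul0r subr0 sqrtr1 invr1.
have K0 := ellK_gt0 h0; rewrite /loop_alpha e.
rewrite pmulr_rgt0 ?mulr_gt0// invr_gt0 pmulr_rgt0 ?divr_gt0//; lra.
Qed.

(** Translates g(q) = lam l^2 / 4 into the relation between multiplier, scale and modulus in the
    elastica equation. Only alpha^2 enters, so arcs and loop are treated alike. *)
Lemma lam_of_gfun lam l q a : 0 < l -> gfun q = lam * l ^+ 2 / 4 ->
  a ^+ 2 = (4 / l * ellM q) ^+ 2 -> lam = 2 * a ^+ 2 * (2 * q ^+ 2 - 1).
Proof.
move=> l0 + ->; rewrite gfunE => h.
have l20 : l ^+ 2 != 0 by rewrite gt_eqF ?exprn_gt0.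
apply: (mulIf l20); rewrite -[LHS](divfK (_ : 4 != 0))// -h; field.
by rewrite gt_eqF.
Qed.

End moduli_choice.

(** * The wavelike curve, its tangent and its curvature *)

Section wavelike_elastica.
Context {R : realType}.
Context (q a sg lam : R).
Context (hq : 0 < q < 1) (a0 : 0 < a) (sg2 : sg ^+ 2 = 1).
Context (lamE : lam = 2 * a ^+ 2 * (2 * q ^+ 2 - 1)).

Let u s := a * s - ellK q.
(** [sg] is 1 for the two arcs and -1 for the loop, whose formula has the opposite first
    coordinate. *)
Definition wave_X1 s := a^-1 * (sg * (2 * ellE (am (u s) q) q + 2 * ellEc q - a * s)).
Definition wave_X2 s := a^-1 * (2 * q * cn (u s) q).
Definition wave_T1 s := sg * (1 - 2 * q ^+ 2 * sn (u s) q ^+ 2).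
Definition wave_T2 s := - (2 * q * (sn (u s) q * dn (u s) q)).
Definition wave_k s := - (2 * sg * q * a * cn (u s) q).
Definition wave_k1 s := 2 * sg * q * a ^+ 2 * (sn (u s) q * dn (u s) q).

Let hq' : 0 <= q < 1. Proof. by case/andP: hq => /ltW -> ->. Qed.
Let an0 : a != 0. Proof. by rewrite gt_eqF. Qed.

Let du s : is_derive s (1 : R) u a.
Proof.
by apply: is_derive_eqv (derD (derM (der_cst a s) (der_id s)) (derN (der_cst (ellK q) s))) _; ring.
Qed.

Let dsn s := der_comp (du s) (derive_sn (u s) hq').
Let dcn s := der_comp (du s) (derive_cn (u s) hq').
Let ddn s := der_comp (du s) (derive_dn (u s) hq').

Let uL s : u (s + 4 * ellK q / a) = u s + 4 * ellK q.
Proof. by rewrite /u; field. Qed.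

(** |k| <= 2 a and |k'| <= 2 a^2 explain the bound. The constant vector is read off where sn = 0:
    there k' = 0, k^2 = 4 q^2 a^2 and T = (sg, 0). *)
Lemma wave_periodic_elastica :
  periodic_elastica lam (4 * ellK q / a) (2 * a + 2 * a ^+ 2) (sg * (4 * q ^+ 2 * a ^+ 2 - lam)) 0
    wave_X1 wave_X2 wave_T1 wave_T2 wave_k wave_k1.
Proof.
have [/andP[q0 q1] a0'] := (hq, ltW a0).
have sg1 : `|sg| = 1.
  by apply/eqP; rewrite -(@eqrXn2 _ 2)// real_normK ?num_real// sg2 expr1n.
have c1 s : `|cn (u s) q| <= 1 by exact: normr_cos_le1.
have s1 s : `|sn (u s) q| <= 1 by exact: normr_sin_le1.
have d1 s : `|dn (u s) q| <= 1 by rewrite ger0_norm ?delta_le1// ltW// delta_gt0.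
split.
- move=> s; apply: is_derive_eqv (derM (der_cst a^-1 s) (derM (der_cst sg s)
    (derD (derD (derM (der_cst 2 s) (der_comp (du s) (derive_ellE_am (u s) hq'))) (der_cst (2 * ellEc q) s))
       (derN (derM (der_cst a s) (der_id s)))))) _.
  by rewrite /wave_T1 dn2E//; field.
- move=> s; apply: is_derive_eqv (derM (der_cst a^-1 s) (derM (der_cst (2 * q) s) (dcn s))) _.
  by rewrite /wave_T2; field.
- move=> s; apply: is_derive_eqv (derM (der_cst sg s) (derD (der_cst 1 s)
    (derN (derM (der_cst (2 * q ^+ 2) s) (derX 2 (dsn s)))))) _.
  rewrite /wave_k /wave_T2 /=; ring.
- move=> s; apply: is_derive_eqv (derN (derM (der_cst (2 * q) s) (derM (dsn s) (ddn s)))) _.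
  rewrite /wave_k /wave_T1.
  transitivity (- (2 * q * a * cn (u s) q * (dn (u s) q ^+ 2 - q ^+ 2 * sn (u s) q ^+ 2))); first by ring.
  rewrite dn2E// -[X in X = _]mul1r -[X in X * _ = _]sg2; ring.
- move=> s; apply: is_derive_eqv (derN (derM (der_cst (2 * sg * q * a) s) (dcn s))) _.
  by rewrite /wave_k1; ring.
- move=> s; rewrite /wave_T1 /wave_T2 exprMn sg2 sqrrN !exprMn dn2E//; ring.
- move=> s; apply: (@le_trans _ _ (2 * 1 * 1 * a * 1)); last by have := sqr_ge0 a; lra.
  rewrite /wave_k normrN !normrM sg1 (ger0_norm a0') (ger0_norm (ltW q0)) ger0_norm//.
  by rewrite !ler_pM// ?mulr_ge0// ltW.
- move=> s; apply: (@le_trans _ _ (2 * 1 * 1 * a ^+ 2 * (1 * 1))); last by lra.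
  apply: normM_le; last exact: normM_le.
  apply: normM_le; last by rewrite ger0_norm// sqr_ge0.
  apply: normM_le; last by rewrite ger0_norm// ltW.
  by apply: normM_le; [exact: norm_nat_le|rewrite sg1].
- by move=> s; rewrite /wave_T1 uL sn_period.
- by move=> s; rewrite /wave_T2 uL sn_period// dn_period.
- by move=> s; rewrite /wave_k uL cn_period.
(* The curve starts at the argument -K, a zero of cn, and cn is positive just after it. *)
- move=> r r0; have K0 := ellK_gt0 hq'; pose e := Num.min (r / 2) (ellK q / a).
  have e0 : 0 < e by rewrite lt_min !divr_gt0.
  have er : e < r by rewrite gt_min ltr_pdivrMr// mulr_natr mulr2n ltrDl r0.
  exists e; first by rewrite e0.
  have : 0 < cn (u e) q.
    apply: cn_gt0 => //; rewrite /u ltrDr mulr_gt0//= ltrBlDr.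
    have : e <= ellK q / a by rewrite ge_min lexx orbT.
    by rewrite ler_pdivlMr// mulrC => h; rewrite (le_lt_trans h)// ltrDl.
  have sgn0 : sg != 0 by rewrite -normr_gt0 sg1.
  by move=> c0; rewrite /wave_k oppr_eq0 !mulf_neq0// gt_eqF.
- move=> s; rewrite /wave_k /wave_k1 /wave_T1 /wave_T2 lamE.
  transitivity (sg * (8 * q ^+ 2 * a ^+ 2 * (sn (u s) q ^+ 2 * dn (u s) q ^+ 2)) +
    (4 * sg ^+ 2 * q ^+ 2 * a ^+ 2 * cn (u s) q ^+ 2 - 2 * a ^+ 2 * (2 * q ^+ 2 - 1)) *
    (sg * (1 - 2 * q ^+ 2 * sn (u s) q ^+ 2))); first by ring.
  by rewrite sg2 dn2E// sn2cn2; ring.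
- move=> s; rewrite /wave_k /wave_k1 /wave_T1 /wave_T2 lamE.
  transitivity (2 * q * (sn (u s) q * dn (u s) q) * (2 * sg ^+ 2 * a ^+ 2 * (1 - 2 * q ^+ 2 * sn (u s) q ^+ 2)
     - (4 * sg ^+ 2 * q ^+ 2 * a ^+ 2 * cn (u s) q ^+ 2 - 2 * a ^+ 2 * (2 * q ^+ 2 - 1)))); first by ring.
  by rewrite sg2 sn2cn2; ring.
Qed.

End wavelike_elastica.

(** * Curves parametrized on the unit interval *)

Section reparametrization.
Context {R : realType}.
Notation mu := (@lebesgue_measure R).
Local Notation itv_integrable a b f := (mu.-integrable `[a, b] (EFin \o f)).
Context (g g1 g2 : R -> R * R) (hW : W22 g g1 g2).
Context (g1_neq0 : forall t, 0 <= t <= 1 -> g1 t <> (0, 0)).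

Let u1 t := (g2 t).1.
Let u2 t := (g2 t).2.
Let hu1 : L2_01 u1. Proof. by case: hW. Qed.
Let hu2 : L2_01 u2. Proof. by case: hW => _ []. Qed.

(* g1 is only constrained on [0, 1]; these extensions of its components are
   continuous on R. *)
Definition ext1 t := (g1 0).1 + oint 0 (clamp 0 1 t) u1.
Definition ext2 t := (g1 0).2 + oint 0 (clamp 0 1 t) u2.

Lemma ext_clamp t : g1 (clamp 0 1 t) = (ext1 t, ext2 t).
Proof. by have [_ [_ [_ ->]]] := hW; [|exact: clamp_itv]. Qed.

Lemma extE t : 0 <= t <= 1 -> g1 t = (ext1 t, ext2 t).
Proof. by move=> ht; rewrite -ext_clamp clamp_id. Qed.

Lemma continuous_ext1 : continuous ext1.
Proof.
apply: continuousRD; first exact: continuousR_cst.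
by apply: continuous_oint_clamp => //; exact: L2_integrable.
Qed.

Lemma continuous_ext2 : continuous ext2.
Proof.
apply: continuousRD; first exact: continuousR_cst.
by apply: continuous_oint_clamp => //; exact: L2_integrable.
Qed.

Lemma ext_at0 : (forall t, ext1 t = ext1 0 + oint 0 (clamp 0 1 t) u1) /\
  (forall t, ext2 t = ext2 0 + oint 0 (clamp 0 1 t) u2).
Proof.
have c0 : clamp 0 1 0 = 0 :> R by apply: clamp_id; rewrite lexx ler01.
by split=> t; rewrite /ext1 /ext2 c0 oint0 addr0.
Qed.

Definition speed t := Num.sqrt (ext1 t ^+ 2 + ext2 t ^+ 2).

Lemma continuous_speed : continuous speed.
Proof.
apply: continuousR_sqrt; apply: continuousRD; apply: continuousRX.
  exact: continuous_ext1.
exact: continuous_ext2.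
Qed.

Lemma speed_gt0 t : 0 < speed t.
Proof.
rewrite sqrtr_gt0 lt_neqAle addr_ge0 ?sqr_ge0// andbT eq_sym paddr_eq0 ?sqr_ge0// !sqrf_eq0.
apply/negP => /andP[/eqP e1 /eqP e2].
by apply: (g1_neq0 (clamp_itv t ler01)); rewrite ext_clamp e1 e2.
Qed.

Lemma speedE t : 0 <= t <= 1 -> vnorm (g1 t) = speed t.
Proof. by move=> /extE ->. Qed.

(** Agrees with [arclen g1] on [0, 1], but is continuously differentiable on the whole line. *)
Definition alen t := oint 0 t speed.

Lemma arc0 : alen 0 = 0. Proof. exact: oint0. Qed.

Lemma derive_arc t : is_derive t (1 : R) alen (speed t).
Proof. exact: derive_oint continuous_speed. Qed.

Lemma continuous_arc : continuous alen.
Proof. exact: continuous_of_derive derive_arc. Qed.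

Lemma oint_congr (f h : R -> R) t : 0 <= t <= 1 -> (forall x, 0 <= x <= 1 -> f x = h x) ->
  oint 0 t f = oint 0 t h.
Proof.
move=> /andP[t0 t1] fh; rewrite !oint_le//; apply: eq_Rintegral => x.
by rewrite inE/= in_itv/= => /andP[x0 xt]; apply: fh; rewrite x0 (le_trans xt).
Qed.

Lemma arcE t : 0 <= t <= 1 -> arclen g1 t = alen t.
Proof. by move=> ht; apply: oint_congr ht _; exact: speedE. Qed.

Context (X1 X2 T1 T2 k : R -> R).
Context (dX1 : forall s, is_derive s (1 : R) X1 (T1 s)).
Context (dX2 : forall s, is_derive s (1 : R) X2 (T2 s)).
Context (dT1 : forall s, is_derive s (1 : R) T1 (- (k s * T2 s))).
Context (dT2 : forall s, is_derive s (1 : R) T2 (k s * T1 s)).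
Context (ck : continuous k) (T_unit : forall s, T1 s ^+ 2 + T2 s ^+ 2 = 1).
Context (gX : forall t, 0 <= t <= 1 -> g t = (X1 (alen t), X2 (alen t))).

Let cT1 := continuous_of_derive dT1.
Let cT2 := continuous_of_derive dT2.
Let cK1 : continuous (fun s => - (k s * T2 s)).
Proof. by apply: continuousRN; exact: continuousRM. Qed.
Let cK2 : continuous (fun s => k s * T1 s).
Proof. exact: continuousRM. Qed.

Lemma derive_comp_arc (Z Y : R -> R) t : (forall s, is_derive s (1 : R) Z (Y s)) ->
  is_derive t (1 : R) (fun t => Z (alen t)) (Y (alen t) * speed t).
Proof. by move=> dZ; exact: der_comp (derive_arc t) (dZ _). Qed.

Lemma continuous_comp_arc (Y : R -> R) : continuous Y -> continuous (fun t => Y (alen t)).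
Proof. exact: continuousR_comp continuous_arc. Qed.

Lemma oint_comp_arc (Z Y : R -> R) t : (forall s, is_derive s (1 : R) Z (Y s)) ->
  continuous Y -> Z (alen t) = Z 0 + oint 0 t (fun t => Y (alen t) * speed t).
Proof.
move=> dZ cY; have cYs : continuous (fun t => Y (alen t) * speed t).
  by apply: continuousRM; [exact: continuous_comp_arc|exact: continuous_speed].
rewrite (oint_derive t cYs (fun t => derive_comp_arc t dZ)) /= arc0; ring.
Qed.

(** The coordinate [c] is both a primitive of [e] and X composed with arclength. Their difference
    vanishes on [0, 1], so its derivative vanishes inside, and by continuity at the ends. *)
Lemma ext_tangent_aux (e X T c : R -> R) (x0 : R) : continuous e -> continuous T ->
  (forall s, is_derive s (1 : R) X (T s)) ->
  (forall t, 0 <= t <= 1 -> c t = x0 + oint 0 t e) ->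
  (forall t, 0 <= t <= 1 -> c t = X (alen t)) ->
  forall t, 0 <= t <= 1 -> e t = T (alen t) * speed t.
Proof.
move=> ce cT dX ch1 ch2 t t01; apply/eqP; rewrite -subr_eq0; apply/eqP; move: t t01.
have cd : continuous (fun t => e t - T (alen t) * speed t).
  apply: continuousRD => //; apply: continuousRN; apply: continuousRM.
    exact: continuous_comp_arc.
  exact: continuous_speed.
apply: continuous_eq0_itv ltr01 cd _ => t /andP[t0 t1].
have d z : is_derive z (1 : R) (fun t => x0 + oint 0 t e + - X (alen t)) (e z - T (alen z) * speed z).
  apply: is_derive_eqv (derD (derD (der_cst x0 z) (derive_oint z ce)) (derN (derive_comp_arc z dX))) _.
  by rewrite add0r.
have e0 : {near t, (fun t => x0 + oint 0 t e + - X (alen t)) =1 (fun=> 0)}.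
  near=> s; rewrite -ch1 -?ch2 ?subrr//; apply/andP; split; apply/ltW; near: s;
    [exact: lt_nbhsr|exact: lt_nbhsl|exact: lt_nbhsr|exact: lt_nbhsl].
have : is_derive t (1 : R) (fun=> (0 : R)) (e t - T (alen t) * speed t).
  by apply: near_eq_is_derive e0 (d t); rewrite oner_eq0.
move=> [_]; have [_] := der_cst (0 : R) t.
by move=> -> <-.
Unshelve. all: by end_near. Qed.

Lemma ext_tangent t : 0 <= t <= 1 ->
  ext1 t = T1 (alen t) * speed t /\ ext2 t = T2 (alen t) * speed t.
Proof.
have [_ [_ [gE _]]] := hW; move=> ht; split.
- apply: (@ext_tangent_aux ext1 X1 T1 (fun t => (g t).1) (g 0).1 continuous_ext1 cT1 dX1) ht.
  + move=> s hs; rewrite gE//=; congr (_ + _); apply: oint_congr hs _ => x hx.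
    by rewrite extE.
  + by move=> s hs; rewrite gX.
- apply: (@ext_tangent_aux ext2 X2 T2 (fun t => (g t).2) (g 0).2 continuous_ext2 cT2 dX2) ht.
  + move=> s hs; rewrite gE//=; congr (_ + _); apply: oint_congr hs _ => x hx.
    by rewrite extE.
  + by move=> s hs; rewrite gX.
Qed.

(* The weak derivative of t |-> speed t * Y (alen t) when Y' = V; since speed is
   the scalar product of g1 with T (alen t), the derivative of speed is taken
   to be that of g2 with T (alen t). *)
Definition second (Y V : R -> R) t :=
  Y (alen t) * (T1 (alen t) * u1 t + T2 (alen t) * u2 t) + speed t ^+ 2 * V (alen t).

Lemma L2_second Y V : continuous Y -> continuous V -> L2_01 (second Y V).
Proof.
move=> cY cV; apply: L2D.
  apply: L2M; first exact: continuous_comp_arc.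
  by apply: L2D; apply: L2M => //; exact: continuous_comp_arc.
apply: L2_cont; apply: continuousRM; first by apply: continuousRX; exact: continuous_speed.
exact: continuous_comp_arc.
Qed.

(** Differentiating the square root in [speed] is avoided: on [0, 1] the product speed Y equals (Y
    T1) [ext1] + (Y T2) [ext2] because T is a unit vector, and each summand is a C^1 function times
    an indefinite integral, as in [oint_product]. *)
Lemma oint_second Y V t : (forall s, is_derive s (1 : R) Y (V s)) -> continuous V ->
  0 <= t <= 1 -> speed t * Y (alen t) = speed 0 * Y (alen 0) + oint 0 t (second Y V).
Proof.
move=> dY cV t01; have cY := continuous_of_derive dY.
have h0 : 0 <= (0 : R) <= 1 by rewrite lexx ler01.
have P (T K e u : R -> R) : (forall s, is_derive s (1 : R) T (K s)) -> continuous K ->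
    continuous e -> L2_01 u -> (forall t, e t = e 0 + oint 0 (clamp 0 1 t) u) ->
    let f t := (V (alen t) * T (alen t) + Y (alen t) * K (alen t)) * speed t in
    itv_integrable 0 t (fun v => f v * e v + Y (alen v) * T (alen v) * u v) /\
    Y (alen t) * T (alen t) * e t = Y (alen 0) * T (alen 0) * e 0 +
     oint 0 t (fun v => f v * e v + Y (alen v) * T (alen v) * u v).
  move=> dT cK ce hu eE /=.
  have cT := continuous_of_derive dT.
  have cf : continuous (fun t => (V (alen t) * T (alen t) + Y (alen t) * K (alen t)) * speed t).
    apply: continuousRM; last exact: continuous_speed.
    by apply: continuousRD; apply: continuousRM; exact: continuous_comp_arc.
  have cF : continuous (fun t => Y (alen t) * T (alen t)).
    by apply: continuousRM; exact: continuous_comp_arc.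
  have iu := L2_integrable hu.
  split.
    apply: (@itv_integrableS _ 0 1) => //; first by case/andP: t01.
    apply: itv_integrableD; first by apply: itv_integrable_cont; exact: continuousRM.
    exact: itv_integrableM.
  apply: (oint_product (T := 1)) t01 => //.
  - move=> s; apply: is_derive_eqv (derive_comp_arc s (fun s => derM (dY s) (dT s))) _.
    by [].
  - by move=> s hs; rewrite [LHS]eE clamp_id.
have [e10 e20] := ext_at0.
have [i1 e1] := P T1 _ ext1 u1 dT1 cK1 continuous_ext1 hu1 e10.
have [i2 e2] := P T2 _ ext2 u2 dT2 cK2 continuous_ext2 hu2 e20.
have key s : 0 <= s <= 1 -> speed s * Y (alen s) =
    Y (alen s) * T1 (alen s) * ext1 s + Y (alen s) * T2 (alen s) * ext2 s.
  move=> hs; have [-> ->] := ext_tangent hs.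
  by rewrite -[LHS]mulr1 -[X in _ * X = _](T_unit (alen s)); ring.
rewrite !key// e1 e2 addrACA; congr (_ + _).
rewrite !oint_le; do ?by case/andP: t01.
rewrite -RintegralD//; apply: eq_Rintegral => v.
rewrite inE/= in_itv/= => /andP[v0 vt].
have v01 : 0 <= v <= 1 by rewrite v0 (le_trans vt)//; case/andP: t01.
have [-> ->] := ext_tangent v01.
(* The terms with [k] cancel, since T' is orthogonal to T. *)
transitivity (Y (alen v) * (T1 (alen v) * u1 v + T2 (alen v) * u2 v) +
  speed v ^+ 2 * (V (alen v) * (T1 (alen v) ^+ 2 + T2 (alen v) ^+ 2))); first by ring.
by rewrite T_unit mulr1.
Qed.

Lemma W22_comp_arc (Z1 Z2 Y1 Y2 V1 V2 : R -> R) :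
  (forall s, is_derive s (1 : R) Z1 (Y1 s)) -> (forall s, is_derive s (1 : R) Z2 (Y2 s)) ->
  (forall s, is_derive s (1 : R) Y1 (V1 s)) -> (forall s, is_derive s (1 : R) Y2 (V2 s)) ->
  continuous V1 -> continuous V2 ->
  W22 (fun t => (Z1 (alen t), Z2 (alen t)))
      (fun t => (speed t * Y1 (alen t), speed t * Y2 (alen t)))
      (fun t => (second Y1 V1 t, second Y2 V2 t)).
Proof.
move=> dZ1 dZ2 dY1 dY2 cV1 cV2.
have [cY1 cY2] := (continuous_of_derive dY1, continuous_of_derive dY2).
split; first exact: L2_second.
split; first exact: L2_second.
have comm (Y : R -> R) : (fun t => speed t * Y (alen t)) = (fun t => Y (alen t) * speed t).
  by apply/funext => t; rewrite mulrC.
split=> t ht; rewrite /vadd /=.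
  by rewrite !comm arc0 (oint_comp_arc t dZ1)// (oint_comp_arc t dZ2).
by congr pair; exact: oint_second.
Qed.

(** On [0, 1] both sides have the same primitive up to a constant, namely the components of g1 =
    speed T. *)
Lemma second_ae : {ae mu, forall t, 0 <= t <= 1 ->
  u1 t = second T1 (fun s => - (k s * T2 s)) t /\ u2 t = second T2 (fun s => k s * T1 s) t}.
Proof.
have [e10 e20] := ext_at0.
have P (T K e u : R -> R) : (forall s, is_derive s (1 : R) T (K s)) -> continuous K -> L2_01 u ->
   (forall t, e t = e 0 + oint 0 (clamp 0 1 t) u) ->
   (forall t, 0 <= t <= 1 -> e t = T (alen t) * speed t) ->
   {ae mu, forall t, 0 <= t <= 1 -> u t - second T K t = 0}.
  move=> dT cK hu eE eT; have cT := continuous_of_derive dT.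
  have h2 := L2_second cT cK.
  apply: oint_eq0_ae; first exact: L2_integrable (L2B hu h2).
  move=> t ht; have h0 : 0 <= (0 : R) <= 1 by rewrite lexx ler01.
  have i t0 f : L2_01 f -> 0 <= t0 <= 1 -> itv_integrable 0 t0 f.
    by move=> /L2_integrable hf /andP[_ t01]; apply: itv_integrableS hf.
  have := oint_second dT cK ht; rewrite ![speed _ * _]mulrC -!eT// eE clamp_id// => /addrI.
  have /andP[t0 _] := ht.
  by rewrite !oint_le// RintegralB//; [move=> ->; rewrite subrr|exact: i|exact: i].
have h1 := P T1 _ ext1 u1 dT1 cK1 hu1 e10 (fun t ht => (ext_tangent ht).1).
have h2 := P T2 _ ext2 u2 dT2 cK2 hu2 e20 (fun t ht => (ext_tangent ht).2).
apply: (@filterS2 _ _ (ae_filter_ringOfSetsType mu) _ _ _ _ h1 h2) => t a1 a2 ht.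
by split; apply/eqP; rewrite -subr_eq0; apply/eqP; [exact: a1|exact: a2].
Qed.

Lemma Rintegral_comp_arc (Z Y : R -> R) : (forall s, is_derive s (1 : R) Z (Y s)) ->
  continuous Y -> Rintegral mu `[0, 1] (fun t => Y (alen t) * speed t) = Z (alen 1) - Z 0.
Proof.
move=> dZ cY; have cYs : continuous (fun t => Y (alen t) * speed t).
  by apply: continuousRM; [exact: continuous_comp_arc|exact: continuous_speed].
by rewrite (Rintegral_derive ler01 cYs (fun t => derive_comp_arc t dZ)) arc0.
Qed.

Lemma energy_comp_arc lam : energy lam g1 g2 = oint 0 (alen 1) (fun s => k s ^+ 2 + lam).
Proof.
have cd : continuous (fun s => k s ^+ 2 + lam).
  by apply: continuousRD; [exact: continuousRX|exact: continuousR_cst].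
have := Rintegral_comp_arc (fun s => derive_oint s cd) cd; rewrite oint0 subr0 => <-.
have -> : energy lam g1 g2 =
    Rintegral mu `[0, 1] (fun t => k (alen t) ^+ 2 * speed t) + lam * Rintegral mu `[0, 1] speed.
  rewrite /energy; congr (_ + lam * _); last by rewrite /curve_length arcE ?ler01 ?lexx// /alen oint_le.
  have cs := continuous_speed.
  have sn0 t : speed t ^+ 5 != 0 by rewrite gt_eqF// exprn_gt0// speed_gt0.
  transitivity (Rintegral mu `[0, 1]
      (fun t => (ext1 t * u2 t - ext2 t * u1 t) ^+ 2 * (speed t ^+ 5)^-1)).
    apply: eq_Rintegral => t; rewrite inE/= in_itv/= => ht.
    by rewrite speedE// /vcross extE.
  apply: Rintegral_ae_eq.
  - have [[m1 _] [m2 _]] := (hu1, hu2).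
    apply: measurable_funM.
      apply: measurable_funX; apply: measurable_funB; apply: measurable_funM => //.
        exact: itv_measurable_cont continuous_ext1.
      exact: itv_measurable_cont continuous_ext2.
    by apply: itv_measurable_cont; apply: continuousRV => //; exact: continuousRX.
  - apply: itv_measurable_cont; apply: continuousRM => //; apply: continuousRX.
    exact: continuous_comp_arc.
  apply: (@filterS _ _ (ae_filter_ringOfSetsType mu) _ _ _ second_ae) => t h ht.
  have [-> ->] := h ht; have [-> ->] := ext_tangent ht; rewrite /second.
  have s0 : speed t != 0 by rewrite gt_eqF// speed_gt0.
  (* [p] is the tangential acceleration; it drops out of the cross product, which leaves speed^3
     k. *)
  set p := _ + T2 _ * _.
  have -> : T1 (alen t) * speed t * (T2 (alen t) * p + speed t ^+ 2 * (k (alen t) * T1 (alen t))) -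
    T2 (alen t) * speed t * (T1 (alen t) * p + speed t ^+ 2 * - (k (alen t) * T2 (alen t))) =
    speed t ^+ 3 * k (alen t) * (T1 (alen t) ^+ 2 + T2 (alen t) ^+ 2) by ring.
  by rewrite T_unit; field.
have is_ : itv_integrable 0 1 speed by apply: itv_integrable_cont; exact: continuous_speed.
rewrite -RintegralZl// -RintegralD//; last 2 first.
- apply: itv_integrable_cont; apply: continuousRM; last exact: continuous_speed.
  by apply: continuousRX; exact: continuous_comp_arc.
- exact: itv_integrableZ.
by apply: eq_Rintegral => t _; rewrite mulrDl.
Qed.

Lemma energy_comp_arc_le (lam : R) (Y1 Y2 V1 V2 b B : R -> R) :
  continuous Y1 -> continuous Y2 -> continuous V1 -> continuous V2 -> continuous b ->
  (forall s, is_derive s (1 : R) B (b s)) ->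
  (forall s, 0 < Y1 s ^+ 2 + Y2 s ^+ 2) ->
  (forall s, (Y1 s * V2 s - Y2 s * V1 s) ^+ 2 / Num.sqrt (Y1 s ^+ 2 + Y2 s ^+ 2) ^+ 5
      + lam * Num.sqrt (Y1 s ^+ 2 + Y2 s ^+ 2) <= b s) ->
  energy lam (fun t => (speed t * Y1 (alen t), speed t * Y2 (alen t)))
      (fun t => (second Y1 V1 t, second Y2 V2 t)) <= B (alen 1) - B 0.
Proof.
move=> cY1 cY2 cV1 cV2 cb dB Y0 hb.
have cs := continuous_speed.
pose N s := Num.sqrt (Y1 s ^+ 2 + Y2 s ^+ 2).
have N0 s : 0 < N s by rewrite sqrtr_gt0.
have cN : continuous N by apply: continuousR_sqrt; apply: continuousRD; exact: continuousRX.
pose c s := (Y1 s * V2 s - Y2 s * V1 s) ^+ 2 / N s ^+ 5.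
have cc : continuous c.
  apply: continuousRM; last first.
    by apply: continuousRV; [move=> s; rewrite gt_eqF// exprn_gt0|exact: continuousRX].
  by apply: continuousRX; apply: continuousRD; [|apply: continuousRN]; exact: continuousRM.
have nE t : vnorm (speed t * Y1 (alen t), speed t * Y2 (alen t)) = N (alen t) * speed t.
  rewrite /vnorm /= !exprMn -mulrDr sqrtrM ?sqr_ge0// sqrtr_sqr gtr0_norm ?speed_gt0//.
  by rewrite mulrC.
have iN : itv_integrable 0 1 (fun t => N (alen t) * speed t).
  by apply: itv_integrable_cont; apply: continuousRM => //; exact: continuous_comp_arc.
have ic : itv_integrable 0 1 (fun t => c (alen t) * speed t).
  by apply: itv_integrable_cont; apply: continuousRM => //; exact: continuous_comp_arc.
rewrite -(Rintegral_comp_arc dB cb).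
have -> : energy lam (fun t => (speed t * Y1 (alen t), speed t * Y2 (alen t)))
      (fun t => (second Y1 V1 t, second Y2 V2 t)) =
    Rintegral mu `[0, 1] (fun t => c (alen t) * speed t) +
    Rintegral mu `[0, 1] (fun t => lam * (N (alen t) * speed t)).
  rewrite RintegralZl// /energy; congr (_ + lam * _).
    apply: eq_Rintegral => t _; rewrite nE /vcross /second /c /=.
    have s0 : speed t != 0 by rewrite gt_eqF// speed_gt0.
    have n0 : N (alen t) != 0 by rewrite gt_eqF.
    by field; rewrite n0 s0.
  rewrite /curve_length /arclen oint_le ?ler01//.
  by apply: eq_Rintegral => t _; rewrite nE.
rewrite -RintegralD//; last exact: itv_integrableZ.
apply: le_Rintegral => //.
- by apply: itv_integrableD => //; exact: itv_integrableZ.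
- by apply: itv_integrable_cont; apply: continuousRM => //; exact: continuous_comp_arc.
- move=> t _; rewrite mulrA -mulrDl ler_pM2r ?speed_gt0//; exact: hb.
Qed.

(** [I] depends only on the given curve and is fixed before the competitor. It is finite because
    [second] uses the same L^2 factor [p] for both curves, so the second derivatives differ by small
    continuous multiples of p and speed^2. *)
Lemma W22_dist_comp_arc : exists2 I : R, 0 <= I & forall (r : R) (Z1 Z2 Y1 Y2 V1 V2 : R -> R),
  0 <= r -> continuous Y1 -> continuous Y2 -> continuous V1 -> continuous V2 ->
  continuous Z1 -> continuous Z2 ->
  (forall s, `|X1 s - Z1 s| <= r /\ `|X2 s - Z2 s| <= r) ->
  (forall s, `|T1 s - Y1 s| <= r /\ `|T2 s - Y2 s| <= r) ->
  (forall s, `|- (k s * T2 s) - V1 s| <= r /\ `|k s * T1 s - V2 s| <= r) ->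
  W22_dist g g1 g2 (fun t => (Z1 (alen t), Z2 (alen t)))
      (fun t => (speed t * Y1 (alen t), speed t * Y2 (alen t)))
      (fun t => (second Y1 V1 t, second Y2 V2 t)) <= Num.sqrt (r ^+ 2 * I).
Proof.
pose p t := T1 (alen t) * u1 t + T2 (alen t) * u2 t.
(* Two components each: positions contribute 1, first derivatives speed^2, and second derivatives 2
   p^2 + 2 speed^4 from (x + y)^2 <= 2 x^2 + 2 y^2. *)
pose Psi t := 2 + 2 * speed t ^+ 2 + 4 * speed t ^+ 4 + 4 * p t ^+ 2.
have cs := continuous_speed.
have hp : L2_01 p by apply: L2D; apply: L2M => //; exact: continuous_comp_arc.
have iPsi : itv_integrable 0 1 Psi.
  apply: itv_integrableD; last by apply: itv_integrableZ; exact: L2_sqr_integrable.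
  apply: itv_integrable_cont; apply: continuousRD; last first.
    by apply: continuousRM; [exact: continuousR_cst|exact: continuousRX].
  apply: continuousRD; first exact: continuousR_cst.
  by apply: continuousRM; [exact: continuousR_cst|exact: continuousRX].
exists (Rintegral mu `[0, 1] Psi).
  apply: Rintegral_ge0 => t _; rewrite /Psi.
  have := sqr_ge0 (speed t); have := sqr_ge0 (p t); have := exprn_even_ge0 (speed t) (isT : ~~ odd 4); lra.
move=> r Z1 Z2 Y1 Y2 V1 V2 r0 cY1 cY2 cV1 cV2 cZ1 cZ2 hZ hY hV.
pose a1 t := X1 (alen t) - Z1 (alen t); pose a2 t := X2 (alen t) - Z2 (alen t).
pose b1 t := speed t * (T1 (alen t) - Y1 (alen t)).
pose b2 t := speed t * (T2 (alen t) - Y2 (alen t)).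
pose c1 t := second T1 (fun s => - (k s * T2 s)) t - second Y1 V1 t.
pose c2 t := second T2 (fun s => k s * T1 s) t - second Y2 V2 t.
pose d t := a1 t ^+ 2 + a2 t ^+ 2 + (b1 t ^+ 2 + b2 t ^+ 2).
have [cX1 cX2] := (continuous_of_derive dX1, continuous_of_derive dX2).
have cd : continuous d.
  apply: continuousRD; apply: continuousRD; apply: continuousRX.
  - by apply: continuousRD; [|apply: continuousRN]; exact: continuous_comp_arc.
  - by apply: continuousRD; [|apply: continuousRN]; exact: continuous_comp_arc.
  - by apply: continuousRM => //; apply: continuousRD; [|apply: continuousRN]; exact: continuous_comp_arc.
  - by apply: continuousRM => //; apply: continuousRD; [|apply: continuousRN]; exact: continuous_comp_arc.
have hY1 := L2_second cY1 cV1; have hY2 := L2_second cY2 cV2.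
have hT1 := L2_second cT1 cK1; have hT2 := L2_second cT2 cK2.
have vn (x y : R * R) : vnorm (vsub x y) ^+ 2 = (x.1 - y.1) ^+ 2 + (x.2 - y.2) ^+ 2.
  by rewrite sqr_sqrtr// addr_ge0 ?sqr_ge0.
have m2 (f : R -> R) : L2_01 f -> measurable_fun (`[0, 1] : set R) (fun x => f x ^+ 2).
  by move=> [mf _]; exact: measurable_funX.
have -> : W22_dist g g1 g2 (fun t => (Z1 (alen t), Z2 (alen t)))
      (fun t => (speed t * Y1 (alen t), speed t * Y2 (alen t)))
      (fun t => (second Y1 V1 t, second Y2 V2 t)) =
    Num.sqrt (Rintegral mu `[0, 1] (fun t => d t + (c1 t ^+ 2 + c2 t ^+ 2))).
  congr Num.sqrt.
  transitivity (Rintegral mu `[0, 1] (fun t => d t +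
      ((u1 t - second Y1 V1 t) ^+ 2 + (u2 t - second Y2 V2 t) ^+ 2))).
    apply: eq_Rintegral => t; rewrite inE/= in_itv/= => ht.
    rewrite !vn /= gX// extE//=; have [-> ->] := ext_tangent ht.
    by rewrite /d /a1 /a2 /b1 /b2; ring.
  apply: Rintegral_ae_eq.
  - apply: measurable_funD; first exact: itv_measurable_cont.
    by apply: measurable_funD; apply: m2; exact: L2B.
  - apply: measurable_funD; first exact: itv_measurable_cont.
    by apply: measurable_funD; apply: m2; exact: L2B.
  apply: (@filterS _ _ (ae_filter_ringOfSetsType mu) _ _ _ second_ae) => t h ht.
  by have [-> ->] := h ht.
rewrite ler_sqrt; last first.
  rewrite mulr_ge0 ?sqr_ge0//; apply: Rintegral_ge0 => t _; rewrite /Psi.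
  have := sqr_ge0 (speed t); have := sqr_ge0 (p t); have := exprn_even_ge0 (speed t) (isT : ~~ odd 4); lra.
rewrite -RintegralZl//; apply: le_Rintegral => //.
- apply: itv_integrableD; first exact: itv_integrable_cont.
  by apply: itv_integrableD; apply: L2_sqr_integrable; exact: L2B.
- exact: itv_integrableZ.
move=> t _.
have sq (x : R) : `|x| <= r -> x ^+ 2 <= r ^+ 2.
  by move=> hx; rewrite -real_normK ?num_real// ler_pXn2r ?nnegrE.
have {}hZ := hZ (alen t); have {}hY := hY (alen t); have {}hV := hV (alen t).
have h1 : a1 t ^+ 2 <= r ^+ 2 by exact: sq hZ.1.
have h2 : a2 t ^+ 2 <= r ^+ 2 by exact: sq hZ.2.
have h3 : b1 t ^+ 2 <= speed t ^+ 2 * r ^+ 2 by rewrite exprMn ler_wpM2l ?sqr_ge0//; exact: sq hY.1.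
have h4 : b2 t ^+ 2 <= speed t ^+ 2 * r ^+ 2 by rewrite exprMn ler_wpM2l ?sqr_ge0//; exact: sq hY.2.
have hc (x y : R) : `|x| <= r -> `|y| <= r ->
    (x * p t + speed t ^+ 2 * y) ^+ 2 <= r ^+ 2 * (2 * p t ^+ 2 + 2 * speed t ^+ 4).
  move=> /sq hx /sq hy.
  have e1 : (x * p t + speed t ^+ 2 * y) ^+ 2 <= 2 * (x ^+ 2 * p t ^+ 2) + 2 * (speed t ^+ 4 * y ^+ 2).
    have := sqr_ge0 (x * p t - speed t ^+ 2 * y); rewrite -subr_ge0 => e; rewrite -subr_ge0.
    by apply: le_trans e _; rewrite subr0 le_eqVlt; apply/orP; left; apply/eqP; ring.
  have e2 : x ^+ 2 * p t ^+ 2 <= r ^+ 2 * p t ^+ 2 by rewrite ler_wpM2r// sqr_ge0.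
  have e3 : speed t ^+ 4 * y ^+ 2 <= speed t ^+ 4 * r ^+ 2 by rewrite ler_wpM2l// exprn_even_ge0.
  lra.
have h5 : c1 t ^+ 2 <= r ^+ 2 * (2 * p t ^+ 2 + 2 * speed t ^+ 4).
  have -> : c1 t = (T1 (alen t) - Y1 (alen t)) * p t
      + speed t ^+ 2 * (- (k (alen t) * T2 (alen t)) - V1 (alen t)) by rewrite /c1 /second /p; ring.
  exact: hc hY.1 hV.1.
have h6 : c2 t ^+ 2 <= r ^+ 2 * (2 * p t ^+ 2 + 2 * speed t ^+ 4).
  have -> : c2 t = (T2 (alen t) - Y2 (alen t)) * p t
      + speed t ^+ 2 * (k (alen t) * T1 (alen t) - V2 (alen t)) by rewrite /c2 /second /p; ring.
  exact: hc hY.2 hV.2.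
rewrite /d /Psi; lra.
Qed.

End reparametrization.

(** * Failure of local minimality *)

Section instability.
Context {R : realType}.

Lemma curve_length_gt0 (g g1 g2 : R -> R * R) : W22 g g1 g2 ->
  (forall t, 0 <= t <= 1 -> g1 t <> (0, 0)) -> 0 < curve_length g1.
Proof.
move=> hW nz; rewrite /curve_length (arcE hW) ?ler01 ?lexx//.
have [|c _] := MVT_segment (f := alen g1 g2) ler01 (fun z _ => derive_arc hW z).
  by apply: continuous_subspaceT; exact: (continuous_arc hW).
by rewrite arc0 !subr0 mulr1 => ->; exact: (speed_gt0 hW nz).
Qed.

Lemma periodic_elastica_not_local_minimizer (lam l L M P1 P2 : R)
    (X1 X2 T1 T2 k k1 : R -> R) (g g1 g2 : R -> R * R) :
  0 < lam -> periodic_elastica lam L M P1 P2 X1 X2 T1 T2 k k1 ->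
  in_A l g g1 g2 -> curve_length g1 = L ->
  (forall t, 0 <= t <= 1 -> g t = (X1 (arclen g1 t), X2 (arclen g1 t))) ->
  ~ local_minimizer lam l g g1 g2.
Proof.
move=> lam0 PE [hW [nz [g0 gl]]] gL gX [_ [delta [delta0 hmin]]].
have L0 : 0 < L by rewrite -gL; exact: curve_length_gt0 hW nz.
have h0 : 0 <= (0 : R) <= 1 by rewrite lexx ler01.
have h1 : 0 <= (1 : R) <= 1 by rewrite lexx ler01.
have arc1 : alen g1 g2 1 = L by rewrite -gL /curve_length (arcE hW).
have gX' t : 0 <= t <= 1 -> g t = (X1 (alen g1 g2 t), X2 (alen g1 g2 t)).
  by move=> ht; rewrite gX// (arcE hW).
have [X10 X20] : X1 0 = 0 /\ X2 0 = 0 by have := gX' 0 h0; rewrite arc0 g0 => -[<- <-].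
have [X1L X2L] : X1 L = l /\ X2 L = 0 by have := gX' 1 h1; rewrite arc1 gl => -[<- <-].
have [dX1 dX2] := (pe_X1 PE, pe_X2 PE); have [dT1 dT2] := (pe_T1 PE, pe_T2 PE).
have [ck T_unit] := (pe_kc PE, pe_unit PE).
have [I I0 hI] := W22_dist_comp_arc hW dX1 dX2 dT1 dT2 ck T_unit gX'.
have I1 : 0 < I + 1 by lra.
(* The distance is at most r sqrt(I), which is below [delta] because I < (I + 1)^2. *)
pose r := delta / (I + 1); have r0 : 0 < r by rewrite divr_gt0.
have [Z1 [Z2 [Y1 [Y2 [V1 [V2 [b [B cp]]]]]]]] := exists_competitor PE lam0 L0 r0 X10 X20.
have cont (f f' : R -> R) : (forall s, is_derive s (1 : R) f (f' s)) -> continuous f.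
  exact: continuous_of_derive.
have cY1 := cont _ _ (cp_Y1 cp); have cY2 := cont _ _ (cp_Y2 cp).
have cZ1 := cont _ _ (cp_Z1 cp); have cZ2 := cont _ _ (cp_Z2 cp).
have hWZ := W22_comp_arc hW dX1 dX2 dT1 dT2 ck T_unit gX'
  (cp_Z1 cp) (cp_Z2 cp) (cp_Y1 cp) (cp_Y2 cp) (cp_V1 cp) (cp_V2 cp).
have hA : in_A l (fun t => (Z1 (alen g1 g2 t), Z2 (alen g1 g2 t)))
    (fun t => (speed g1 g2 t * Y1 (alen g1 g2 t), speed g1 g2 t * Y2 (alen g1 g2 t)))
    (fun t => (second g1 g2 T1 T2 Y1 V1 t, second g1 g2 T1 T2 Y2 V2 t)).
  split; first exact: hWZ.
  split; last first.
    by split; [rewrite arc0 (cp_Z10 cp) (cp_Z20 cp)|rewrite arc1 (cp_Z1L cp) (cp_Z2L cp) X1L X2L].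
  have sn0 t : speed g1 g2 t != 0 by rewrite gt_eqF// (speed_gt0 hW nz).
  move=> t _ [/eqP]; rewrite mulf_eq0 (negbTE (sn0 t))/= => /eqP e1 /eqP.
  rewrite mulf_eq0 (negbTE (sn0 t))/= => /eqP e2.
  by have := cp_Ynz cp (alen g1 g2 t); rewrite e1 e2 expr0n addr0 ltxx.
have rI : Num.sqrt (r ^+ 2 * I) < delta.
  rewrite -[ltRHS]gtr0_norm// -sqrtr_sqr ltr_sqrt ?exprn_gt0//.
  rewrite /r expr_div_n mulrAC ltr_pdivrMr ?exprn_gt0//.
  by rewrite ltr_pM2l ?exprn_gt0//; have := sqr_ge0 I; nra.
have hdist := le_lt_trans (hI r Z1 Z2 Y1 Y2 V1 V2 (ltW r0) cY1 cY2 (cp_V1 cp) (cp_V2 cp)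
  cZ1 cZ2 (cp_near0 cp) (cp_near1 cp) (cp_near2 cp)) rI.
have := hmin _ _ _ hA hdist.
rewrite (energy_comp_arc hW nz dX1 dX2 dT1 dT2 ck T_unit gX') arc1.
have le2 := energy_comp_arc_le hW nz T1 T2 cY1 cY2 (cp_V1 cp) (cp_V2 cp)
  (cp_b cp) (cp_B cp) (cp_Ynz cp) (cp_density cp).
rewrite arc1 in le2.
by move=> /le_lt_trans /(_ (le_lt_trans le2 (cp_lt cp))); rewrite ltxx.
Qed.

Lemma wave_not_local_minimizer (lam l q a sg : R) (g g1 g2 : R -> R * R) :
  0 < lam -> 0 < l -> 0 < q < 1 -> gfun q = lam * l ^+ 2 / 4 ->
  sg ^+ 2 = 1 -> a ^+ 2 = (4 / l * ellM q) ^+ 2 -> in_A l g g1 g2 ->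
  arclength_param_is g g1 (fun s => (wave_X1 q a sg s, wave_X2 q a s)) (4 * ellK q / a) ->
  ~ local_minimizer lam l g g1 g2.
Proof.
move=> lam0 l0 hq gq sg2 a2 gA [gL gX].
have hq' : 0 <= q < 1 by case/andP: hq => /ltW -> ->.
(* The sign of alpha comes from the curve itself: its length 4 K / a is positive. *)
have a0 : 0 < a.
  have := gA => -[hW [nz _]]; have := curve_length_gt0 hW nz; rewrite gL.
  by rewrite pmulr_rgt0 ?mulr_gt0 ?ellK_gt0// invr_gt0.
have PE := wave_periodic_elastica hq a0 sg2 (lam_of_gfun l0 gq a2).
exact: periodic_elastica_not_local_minimizer lam0 PE gA gL gX.
Qed.

End instability.

Theorem theorem3p8 (R : realType) (lam l : R) (g g1 g2 : R -> R * R) :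
  0 < lam -> 0 < l ->
  pinned_elastica lam l g g1 g2 ->
  ((lam * l ^+ 2 <= 4 * lambdahat /\
      (arclength_param_is g g1 (gamma_sarc lam l) (len_sarc lam l) \/
       arclength_param_is g g1 (gamma_larc lam l) (len_larc lam l))) \/
   arclength_param_is g g1 (gamma_loop lam l) (len_loop lam l)) ->
  ~ local_minimizer lam l g g1 g2.
Proof.
move=> lam0 l0 [gA _].
have arc_case q : 0 < q < 1 -> gfun q = lam * l ^+ 2 / 4 ->
    arclength_param_is g g1 (arc_curve l q) (4 * ellK q / arc_alpha l q) ->
    ~ local_minimizer lam l g g1 g2.
  move=> hq gq [gL gX].
  apply: (wave_not_local_minimizer lam0 l0 hq gq (expr1n _ 2) (erefl _) gA).
  split; first exact: gL.
  by move=> t ht; rewrite gX// /arc_curve /wave_X1 /wave_X2 mul1r.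
case=> [[hl [|]]|].
- by have [hq gq] := q_sarc_spec lam0 l0 hl; exact: arc_case.
- by have [hq gq] := q_larc_spec lam0 l0 hl; exact: arc_case.
- move=> [gL gX].
  have := gA => -[hW [nz _]]; have := curve_length_gt0 hW nz; rewrite gL => L0.
  have [hq gq] := q_loop_spec l0 L0.
  apply: (@wave_not_local_minimizer _ lam l (q_loop lam l) (loop_alpha l (q_loop lam l)) (-1)) => //.
  + by rewrite sqrrN expr1n.
  + by rewrite /loop_alpha /ellM -[RHS]sqrrN; congr (_ ^+ 2); ring.
  + split; first exact: gL.
    move=> t ht; rewrite gX// /gamma_loop /loop_curve /wave_X1 /wave_X2.
    by congr (_ * _, _); ring.
Qed.
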